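(* Let $E$ be a holomorphic vector bundle over a complex manifold $X$, equipped with a Hermitian structure $h$. Then there exists a unique connection on $E$ that is compatible simultaneously with the Hermitian structure and with the holomorphic structure of $E$.
   Context: Let $\mathcal{A}^k(E)$ (resp. $\mathcal{A}^{p,q}(E)$) be the sheaf of smooth complex $k$-forms (resp. $(p,q)$-forms) with values in $E$. A Hermitian structure is a smoothly varying Hermitian inner product on the fibres of $E$. A connection on $E$ is a $\mathbb{C}$-linear sheaf morphism $\nabla:\mathcal{A}^0(E)\to\mathcal{A}^1(E)$ with $\nabla(fs)=df\otimes s+f\nabla s$ for smooth functions $f$ and sections $s$. It is compatible with $h$ if $d\,h(s,t)=h(\nabla s,t)+h(s,\nabla t)$ for all local smooth sections $s,t$, where $h(\alpha\otimes s,\beta\otimes t)=\alpha\wedge\bar\beta\, h(s,t)$. It is compatible with the holomorphic structure if its component $\nabla^{0,1}:\mathcal{A}^0(E)\to\mathcal{A}^{0,1}(E)$ equals $\bar\partial_E$, where $\bar\partial_E(\sum_i f_i s_i)=\sum_i\bar\partial f_i\otimes s_i$ for any local holomorphic frame $(s_i)$ of $E$. *)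

(* Defs.v *)
From HB Require Import structures.
From mathcomp Require Import all_boot all_order all_algebra.
From mathcomp Require Import complex.
From mathcomp Require Import all_classical all_reals all_analysis.

Set Implicit Arguments.
Unset Strict Implicit.
Unset Printing Implicit Defensive.

Import Order.TTheory GRing.Theory Num.Theory.
Import numFieldNormedType.Exports.

Local Open Scope classical_set_scope.
Local Open Scope ring_scope.
Local Open Scope complex_scope.

(* The topology of C^n and its structure of real normed space, which
   [differentiable] and ['D_v f] refer to, are those of R^n x R^n under the
   identification z = p.1 + i p.2. *)

Definition toC (R : realType) n (p : 'rV[R]_n * 'rV[R]_n) : 'rV[R[i]]_n :=
  \row_k (p.1 0 k +i* p.2 0 k).

Definition ofC (R : realType) n (z : 'rV[R[i]]_n) : 'rV[R]_n * 'rV[R]_n :=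
  (\row_k complex.Re (z 0 k), \row_k complex.Im (z 0 k)).

Definition rdifferentiable (R : realType) n (f : 'rV[R[i]]_n -> R[i])
    (z : 'rV[R[i]]_n) : Prop :=
  differentiable (fun p => complex.Re (f (toC p)) : R) (ofC z) /\
  differentiable (fun p => complex.Im (f (toC p)) : R) (ofC z).

Definition rderive (R : realType) n (v : 'rV[R[i]]_n)
    (f : 'rV[R[i]]_n -> R[i]) (z : 'rV[R[i]]_n) : R[i] :=
  ('D_(ofC v) (fun p => complex.Re (f (toC p)) : R) (ofC z)) +i*
  ('D_(ofC v) (fun p => complex.Im (f (toC p)) : R) (ofC z)).

Definition rderive_row (R : realType) m n (v : 'rV[R[i]]_m)
    (f : 'rV[R[i]]_m -> 'rV[R[i]]_n) (z : 'rV[R[i]]_m) : 'rV[R[i]]_n :=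
  \row_k rderive v (fun w => f w 0 k) z.

(* C^oo in the real sense: all the iterated directional derivatives are Frechet
   differentiable (hence continuous) at every point of W. *)
Definition smooth_on (R : realType) n (W : set 'rV[R[i]]_n)
    (f : 'rV[R[i]]_n -> R[i]) : Prop :=
  forall (vs : seq 'rV[R[i]]_n) z, W z ->
    rdifferentiable (foldr (@rderive R n) f vs) z.

(* Smooth functions satisfying the Cauchy-Riemann equations: the real
   derivative is C-linear. *)
Definition holomorphic_on (R : realType) n (W : set 'rV[R[i]]_n)
    (f : 'rV[R[i]]_n -> R[i]) : Prop :=
  smooth_on W f /\
  forall z v, W z -> rderive ('i *: v) f z = 'i * rderive v f z.

(* [cinv i] is the inverse of the chart [cmap i : cdom i -> C^n]; both are total
   functions, whose values outside [cdom i] and [cmap i @` cdom i] are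
   irrelevant. *)
Record complexManifold (R : realType) (n : nat) := ComplexManifold {
  carrier :> topologicalType;
  manifold_hausdorff : hausdorff_space carrier;
  manifold_second_countable : @second_countable carrier;
  chart : Type;
  cdom : chart -> set carrier;
  cmap : chart -> carrier -> 'rV[R[i]]_n;
  cinv : chart -> 'rV[R[i]]_n -> carrier;
  cdom_open : forall i, open (cdom i);
  cimage_open : forall i, open ((@ofC R n \o cmap i) @` cdom i);
  cmapK : forall i x, cdom i x -> cinv i (cmap i x) = x;
  cmap_continuous : forall i, {within cdom i, continuous (@ofC R n \o cmap i)};
  cinv_continuous : forall i,
    {within (@ofC R n \o cmap i) @` cdom i, continuous (cinv i \o @toC R n)};
  chart_cover : forall x, exists i, cdom i x;
  chart_holomorphic : forall i j k,
    holomorphic_on (cmap i @` (cdom i `&` cdom j))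
      (fun z => cmap j (cinv i z) 0 k)
}.

Arguments cdom {R n c} _.
Arguments cmap {R n c} _.
Arguments cinv {R n c} _.

Definition smooth_fun (R : realType) n (X : complexManifold R n) (U : set X)
    (f : X -> R[i]) : Prop :=
  forall i : chart X, smooth_on (cmap i @` (U `&` cdom i)) (f \o cinv i).

Definition holomorphic_fun (R : realType) n (X : complexManifold R n)
    (U : set X) (f : X -> R[i]) : Prop :=
  forall i : chart X, holomorphic_on (cmap i @` (U `&` cdom i)) (f \o cinv i).

(* The derivative at x of the change of charts from i to j. *)
Definition dchart (R : realType) n (X : complexManifold R n) (i j : chart X)
    (x : X) (v : 'rV[R[i]]_n) : 'rV[R[i]]_n :=
  rderive_row v (cmap j \o cinv i) (cmap i x).

Arguments dchart {R n X} i j x v.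

(* Functions and sections over U are defined on the points of U only;
   [ext0] extends them by zero. *)
Definition ext0 (T : Type) (U : set T) (F : T -> zmodType)
    (s : forall x, U x -> F x) (x : T) : F x :=
  match pselect (U x) with left Ux => s x Ux | right _ => 0 end.

Definition local_fun (R : realType) n (X : complexManifold R n) (U : set X) :=
  forall x, U x -> R[i].

Definition smooth_local_fun (R : realType) n (X : complexManifold R n)
    (U : set X) (f : local_fun U) : Prop :=
  smooth_fun U (ext0 (F := fun=> R[i]) f).

(* A family of complex vector spaces with local trivializations
   [triv a x : E x -> C^r], for x in [tdom a], whose transition functions
   g : tdom a `&` tdom b -> GL_r(C) are holomorphic. *)
Record holomorphicBundle (R : realType) n (X : complexManifold R n) (r : nat) :=
  HolomorphicBundle {
  fiber :> X -> lmodType R[i];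
  trivialization : Type;
  tdom : trivialization -> set X;
  triv : trivialization -> forall x, {linear fiber x -> 'rV[R[i]]_r};
  tdom_open : forall a, open (tdom a);
  triv_bij : forall a x, tdom a x -> bijective (triv a x);
  triv_cover : forall x, exists a, tdom a x;
  triv_holomorphic : forall a b, exists g : X -> 'M[R[i]]_r,
    (forall k l, holomorphic_fun (tdom a `&` tdom b) (fun x => g x k l)) /\
    (forall x (e : fiber x), tdom a x -> tdom b x ->
       triv b x e = triv a x e *m g x)
}.

Arguments tdom {R n X r h} _.
Arguments triv {R n X r h} _ _.

Definition local_section (R : realType) n (X : complexManifold R n) r
    (E : holomorphicBundle X r) (U : set X) :=
  forall x, U x -> E x.

Definition smooth_section (R : realType) n (X : complexManifold R n) r
    (E : holomorphicBundle X r) (U : set X) (s : local_section E U) : Prop :=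
  forall (a : trivialization E) k,
    smooth_fun (U `&` tdom a) (fun x => triv a x (ext0 s x) 0 k).

Definition holomorphic_section (R : realType) n (X : complexManifold R n) r
    (E : holomorphicBundle X r) (U : set X) (s : local_section E U) : Prop :=
  forall (a : trivialization E) k,
    holomorphic_fun (U `&` tdom a) (fun x => triv a x (ext0 s x) 0 k).

Definition holomorphic_frame (R : realType) n (X : complexManifold R n) r
    (E : holomorphicBundle X r) (U : set X) (s : 'I_r -> local_section E U) :
    Prop :=
  (forall k, holomorphic_section (s k)) /\
  (forall x (Ux : U x) (e : E x),
     exists! c : 'rV[R[i]]_r, e = \sum_k c 0 k *: s k x Ux).

Record A0 (R : realType) n (X : complexManifold R n) r
    (E : holomorphicBundle X r) (U : set X) := MkA0 {
  A0_val :> forall x, U x -> E x;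
  A0_smooth : smooth_section A0_val
}.

(* A tangent vector at x is the class of a pair (i, v), where i is a chart
   around x and v a vector of C^n, modulo (i, v) ~ (j, dchart i j x v). A
   complex 1-form with values in E over U is an R-linear map from T_x X to E x
   for each x in U; it is given by its values w i v x _ on the classes of the
   pairs (i, v). *)
Definition local_form (R : realType) n (X : complexManifold R n) r
    (E : holomorphicBundle X r) (U : set X) :=
  forall i : chart X, 'rV[R[i]]_n -> local_section E (U `&` cdom i).

Record A1 (R : realType) n (X : complexManifold R n) r
    (E : holomorphicBundle X r) (U : set X) := MkA1 {
  A1_val :> forall i : chart X,
    'rV[R[i]]_n -> forall x, (U `&` cdom i) x -> E x;
  A1_linear : forall i (a : R) (v w : 'rV[R[i]]_n) x Ux,
    @A1_val i (a%:C *: v + w) x Ux = a%:C *: @A1_val i v x Ux + @A1_val i w x Ux;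
  A1_chart : forall i j v x (Ui : (U `&` cdom i) x) (Uj : (U `&` cdom j) x),
    @A1_val i v x Ui = @A1_val j (dchart i j x v) x Uj;
  A1_smooth : forall i v, smooth_section (@A1_val i v)
}.

(* The (0,1)-component of a form: its C-antilinear part. *)
Definition form01 (R : realType) n (X : complexManifold R n) r
    (E : holomorphicBundle X r) (U : set X) (w : local_form E U) :
    local_form E U :=
  fun i v x Ux => 2^-1 *: (w i v x Ux + 'i *: w i ('i *: v) x Ux).

(* d f and its (0,1)-component, in the representation of [local_form]. *)
Definition d0 (R : realType) n (X : complexManifold R n) (U : set X)
    (f : local_fun U) (i : chart X) (v : 'rV[R[i]]_n) :
    local_fun (U `&` cdom i) :=
  fun x _ => rderive v (ext0 (F := fun=> R[i]) f \o cinv i) (cmap i x).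

Definition dbar0 (R : realType) n (X : complexManifold R n) (U : set X)
    (f : local_fun U) (i : chart X) (v : 'rV[R[i]]_n) :
    local_fun (U `&` cdom i) :=
  fun x Ux => 2^-1 * (d0 f v Ux + 'i * d0 f ('i *: v) Ux).

(* The linear combination c s + t and the product f s, which are again smooth,
   appear as any u in A^0(E)(U) with the required values. *)
Record connection (R : realType) n (X : complexManifold R n) r
    (E : holomorphicBundle X r) := Connection {
  nabla :> forall U : set X, open U -> A0 E U -> A1 E U;
  nabla_restrict : forall (U V : set X) (oU : open U) (oV : open V)
      (s : A0 E U) (t : A0 E V),
    V `<=` U ->
    (forall x (Ux : U x) (Vx : V x), t x Vx = s x Ux) ->
    forall i v x (Ux : (U `&` cdom i) x) (Vx : (V `&` cdom i) x),
      @nabla V oV t i v x Vx = @nabla U oU s i v x Ux;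
  nabla_linear : forall (U : set X) (oU : open U) (c : R[i]) (s t u : A0 E U),
    (forall x (Ux : U x), u x Ux = c *: s x Ux + t x Ux) ->
    forall i v x Ux,
      @nabla U oU u i v x Ux = c *: @nabla U oU s i v x Ux + @nabla U oU t i v x Ux;
  nabla_leibniz : forall (U : set X) (oU : open U) (f : local_fun U)
      (s u : A0 E U),
    smooth_local_fun f ->
    (forall x (Ux : U x), u x Ux = f x Ux *: s x Ux) ->
    forall i v x (Ux : (U `&` cdom i) x),
      @nabla U oU u i v x Ux =
      d0 f v Ux *: s x Ux.1 + f x Ux.1 *: @nabla U oU s i v x Ux
}.

Record hermitianStructure (R : realType) n (X : complexManifold R n) r
    (E : holomorphicBundle X r) := HermitianStructure {
  herm :> forall x, {dot E x for @Num.conj R[i]};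
  herm_smooth : forall (U : set X), open U -> forall s t : A0 E U,
    smooth_local_fun (fun x (Ux : U x) => herm x (s x Ux) (t x Ux))
}.

(* h(alpha (x) s, t) = alpha h(s, t) and h(s, beta (x) t) = conj(beta) h(s, t),
   so that the value of h(w, t) at v is h(w(v), t), and likewise on the
   right. *)
Definition hermitian_compatible (R : realType) n (X : complexManifold R n) r
    (E : holomorphicBundle X r) (h : hermitianStructure E) (D : connection E) :
    Prop :=
  forall (U : set X) (oU : open U) (s t : A0 E U) i v x (Ux : (U `&` cdom i) x),
    d0 (fun y (Uy : U y) => h y (s y Uy) (t y Uy)) v Ux =
    h x (D U oU s i v x Ux) (t x Ux.1) + h x (s x Ux.1) (D U oU t i v x Ux).

(* P is the operator dbar_E: it sends sum_k f_k s_k to sum_k dbar f_k (x) s_k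
   for every local holomorphic frame s. *)
Definition is_dbarE (R : realType) n (X : complexManifold R n) r
    (E : holomorphicBundle X r)
    (P : forall U : set X, open U -> A0 E U -> local_form E U) : Prop :=
  forall (U : set X) (oU : open U) (s : 'I_r -> local_section E U)
      (f : 'I_r -> local_fun U) (u : A0 E U),
    holomorphic_frame s ->
    (forall k, smooth_local_fun (f k)) ->
    (forall x (Ux : U x), u x Ux = \sum_k f k x Ux *: s k x Ux) ->
    forall i v x (Ux : (U `&` cdom i) x),
      P U oU u i v x Ux = \sum_k dbar0 (f k) v Ux *: s k x Ux.1.

Definition holomorphic_compatible (R : realType) n (X : complexManifold R n) r
    (E : holomorphicBundle X r) (D : connection E) : Prop :=
  is_dbarE (fun U oU s => form01 (A1_val (D U oU s))).

(* Main.v *)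
Require Import Defs.
From mathcomp Require Import all_boot all_order all_algebra.
From mathcomp Require Import complex.
From mathcomp Require Import all_classical all_reals all_analysis.
From mathcomp Require Import perm ring.

(** In a local holomorphic frame with Gram matrix [H], a section with row of
    components [s] satisfies [h(s, t) = s H t^*], and the operator
    [nabla s = d s + s (del H) H^-1] is compatible with [h] because
    [d H = del H + (del H)^*], and with the holomorphic structure because
    [(del H) H^-1] has type (1,0). If [g] is the holomorphic matrix of a change
    of frame, then [H = g H' g^*] and [del g^* = 0], so these local operators
    agree on overlaps and define a global connection.

    For uniqueness, compatibility with the holomorphic structure prescribes the
    (0,1)-component of [nabla s], and polarizing compatibility with [h] along
    [v] and [i v] shows that [d h(s, t)] and the (0,1)-component of [nabla t]
    determine [h] of the (1,0)-component of [nabla s] with [t]. *)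

Set Implicit Arguments.
Unset Strict Implicit.
Unset Printing Implicit Defensive.

Import Order.TTheory GRing.Theory Num.Theory.
Import numFieldNormedType.Exports.

Local Open Scope classical_set_scope.
Local Open Scope ring_scope.
Local Open Scope complex_scope.

(** * Real differential calculus on C^n *)

(** No sheaf gluing is carried out. The value of nabla s at x is computed in a trivialization chosen
    at x, with no regularity of this choice in x. The change of frame formula turns it into the
    formula of any fixed trivialization around x, and smoothness and both compatibilities are read
    off there. Functions, components and inverse charts are total, with meaningless values outside
    some open set. Identities therefore hold on open sets only, and may be differentiated only
    because derivatives depend on germs. Smoothness is a condition on all iterated real derivatives,
    so its stability under products, inverses and changes of chart has to be established before any
    formula can be used. *)

Lemma near_eq_differentiable (K : numFieldType) (V W : normedModType K)
    (f g : V -> W) (x : V) :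
  (\near x, f x = g x) -> differentiable f x -> differentiable g x.
Proof.
move=> fg df.
have fgx : f x = g x by exact: nbhs_singleton fg.
have fgh : \forall h \near (0 : V), f (h + x) = g (h + x).
  by move: fg; rewrite (near_shift 0 x) /= subr0.
(* The first-order expansion of [f] at [x] is also one of [g]; uniqueness of the differential then
   gives ['d g x = 'd f x]. *)
have gE : g \o shift x = cst (g x) + 'd f x +o_ 0 id.
  apply/eqaddoP => e e0.
  have /eqaddoP/(_ e e0) := diff_locally df.
  apply: filter_app; near=> h.
  have := near fgh h => /(_ _)/= fgh'.
  by rewrite /shift !fctE /= fgx fgh'.
have dgE := diff_unique (diff_continuous df) gE.
by apply/diff_locallyP; rewrite dgE; split => //; exact: diff_continuous.
Unshelve. all: by end_near. Qed.

Lemma addcE (R : rcfType) (a b c d : R) :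
  (a +i* b) + (c +i* d) = (a + c) +i* (b + d).
Proof. by []. Qed.

Lemma mulcE (R : rcfType) (a b c d : R) :
  (a +i* b) * (c +i* d) = (a * c - b * d) +i* (a * d + b * c).
Proof. by []. Qed.

Section RealCalculus.
Variables (R : realType) (n : nat).
Implicit Types (f g : 'rV[R[i]]_n -> R[i]) (z v w : 'rV[R[i]]_n).

Lemma ofCK : cancel (@ofC R n) (@toC R n).
Proof. by move=> z; apply/rowP => k; rewrite !mxE /=; case: (z 0 k). Qed.

Lemma ofC_linear (a : R) v w : ofC (a%:C *: v + w) = a *: ofC v + ofC w.
Proof.
congr (_, _); apply/rowP => k; rewrite !mxE;
by case: (v 0 k) (w 0 k) => [b c] [d e] /=; rewrite mul0r ?subr0 ?addr0.
Qed.

Let re f p : R := complex.Re (f (toC p)).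
Let im f p : R := complex.Im (f (toC p)).

Lemma rdifferentiableD f g z : rdifferentiable f z -> rdifferentiable g z ->
  rdifferentiable (fun w => f w + g w) z.
Proof.
move=> [fr fi] [gr gi]; split.
  rewrite (_ : (fun p => _) = re f + re g); first exact: differentiableD.
  by apply/funext => p; rewrite /re /GRing.add /=; case: (f _) (g _) => ? ? [].
rewrite (_ : (fun p => _) = im f + im g); first exact: differentiableD.
by apply/funext => p; rewrite /im /GRing.add /=; case: (f _) (g _) => ? ? [].
Qed.

Lemma rderiveD v f g z : rdifferentiable f z -> rdifferentiable g z ->
  rderive v (fun w => f w + g w) z = rderive v f z + rderive v g z.
Proof.
move=> [fr fi] [gr gi]; rewrite /rderive.
rewrite (_ : (fun p => complex.Re _) = re f + re g); last first.
  by apply/funext => p; rewrite /re /GRing.add /=; case: (f _) (g _) => ? ? [].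
rewrite (_ : (fun p => complex.Im _) = im f + im g); last first.
  by apply/funext => p; rewrite /im /GRing.add /=; case: (f _) (g _) => ? ? [].
by rewrite !deriveD //; exact: diff_derivable.
Qed.

Lemma rdifferentiable_cst (c : R[i]) z : rdifferentiable (fun=> c) z.
Proof. by split; exact: differentiable_cst. Qed.

Lemma rderive_cst v (c : R[i]) z : rderive v (fun=> c) z = 0.
Proof. by rewrite /rderive !derive_cst. Qed.

Lemma rdifferentiableM f g z : rdifferentiable f z -> rdifferentiable g z ->
  rdifferentiable (fun w => f w * g w) z.
Proof.
move=> [fr fi] [gr gi]; split.
  rewrite (_ : (fun p => _) = re f * re g - im f * im g).
    by apply: differentiableB; exact: differentiableM.
  by apply/funext => p; rewrite /re /im !fctE; case: (f _) (g _) => ? ? [].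
rewrite (_ : (fun p => _) = re f * im g + im f * re g).
  by apply: differentiableD; exact: differentiableM.
by apply/funext => p; rewrite /re /im !fctE; case: (f _) (g _) => ? ? [].
Qed.

Lemma rderiveM v f g z : rdifferentiable f z -> rdifferentiable g z ->
  rderive v (fun w => f w * g w) z = rderive v f z * g z + f z * rderive v g z.
Proof.
move=> [fr fi] [gr gi]; rewrite /rderive.
rewrite (_ : (fun p => complex.Re _) = re f * re g - im f * im g); last first.
  by apply/funext => p; rewrite /re /im !fctE; case: (f _) (g _) => ? ? [].
rewrite (_ : (fun p => complex.Im _) = re f * im g + im f * re g); last first.
  by apply/funext => p; rewrite /re /im !fctE; case: (f _) (g _) => ? ? [].
have dM (F G : 'rV[R]_n * 'rV[R]_n -> R) :
    differentiable F (ofC z) -> differentiable G (ofC z) ->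
    'D_(ofC v) (F * G) (ofC z) =
    F (ofC z) * 'D_(ofC v) G (ofC z) + G (ofC z) * 'D_(ofC v) F (ofC z) :> R.
  by move=> dF dG; apply: deriveM; exact: diff_derivable.
rewrite deriveB ?deriveD ?dM //;
  do ?[by apply: diff_derivable | by apply/diff_derivable/differentiableM].
move: ('D__ (re f) _) ('D__ (im f) _) ('D__ (re g) _) ('D__ (im g) _).
rewrite /re /im ofCK => p q p' q'.
case: (f z) (g z) => a b [c d] /=.
by rewrite !mulcE !addcE; congr (_ +i* _); ring.
Qed.

Lemma rdifferentiable_conj f z : rdifferentiable f z ->
  rdifferentiable (fun w => Num.conj (f w)) z.
Proof.
move=> [fr fi]; split.
  rewrite (_ : (fun p => _) = re f) //.
  by apply/funext => p; rewrite /re; case: (f _).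
rewrite (_ : (fun p => _) = - im f); first exact: differentiableN.
by apply/funext => p; rewrite /im !fctE; case: (f _).
Qed.

Lemma rderive_conj v f z : rdifferentiable f z ->
  rderive v (fun w => Num.conj (f w)) z = Num.conj (rderive v f z).
Proof.
move=> [fr fi]; rewrite /rderive.
rewrite (_ : (fun p => complex.Re (Num.conj _)) = re f); last first.
  by apply/funext => p; rewrite /re; case: (f _).
rewrite (_ : (fun p => complex.Im (Num.conj _)) = - im f); last first.
  by apply/funext => p; rewrite /im !fctE; case: (f _).
by rewrite deriveN //; exact: diff_derivable.
Qed.

Lemma rdifferentiableV f z : rdifferentiable f z -> f z != 0 ->
  rdifferentiable (fun w => (f w)^-1) z.
Proof.
move=> [fr fi] fz0.
(* [q] is |f|^2, and 1/f = conj(f) / |f|^2 has real part Re f / q and imaginary part - Im f / q. *)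
pose q := re f * re f + im f * im f.
have dq : differentiable q (ofC z).
  by apply: differentiableD; exact: differentiableM.
have q0 : q (ofC z) != 0.
  rewrite /q !fctE /re /im ofCK; case: (f z) fz0 => a b; apply: contra => /=.
  by rewrite -!expr2 paddr_eq0 ?sqr_ge0 // !sqrf_eq0 eq_complex.
split.
  rewrite (_ : (fun p => _) = re f * (fun p => (q p)^-1)).
    by apply: differentiableM => //; exact: differentiableV.
  by apply/funext => p; rewrite /q /re /im !fctE; case: (f _).
rewrite (_ : (fun p => _) = (- im f) * (fun p => (q p)^-1)).
  by apply: differentiableM; [exact: differentiableN | exact: differentiableV].
by apply/funext => p; rewrite /q /re /im !fctE; case: (f _) => a b /=;
  rewrite mulNr.
Qed.

Lemma rderive_linear (a : R) v w f z : rdifferentiable f z ->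
  rderive (a%:C *: v + w) f z = a%:C * rderive v f z + rderive w f z.
Proof.
have dlin (F : 'rV[R]_n * 'rV[R]_n -> R) u u' : differentiable F (ofC z) ->
    'D_(a *: u + u') F (ofC z) = a * 'D_u F (ofC z) + 'D_u' F (ofC z).
  by move=> dF; rewrite !deriveE // linearP.
move=> [fr fi]; rewrite /rderive ofC_linear (dlin _ _ _ fr) (dlin _ _ _ fi).
move: ('D__ _ _) ('D__ _ _) ('D__ _ _) ('D__ _ _) => p q p' q'.
by rewrite mulcE addcE; congr (_ +i* _); ring.
Qed.

End RealCalculus.

Lemma differentiable_row (K : numFieldType) (V : normedModType K) m
    (F : V -> 'rV[K]_m) (x : V) :
  (forall k, differentiable (fun y => F y 0 k) x) ->
  differentiable F x /\
  forall v, 'D_v F x = \row_k 'D_v (fun y => F y 0 k) x.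
Proof.
move=> dF.
have dFe k : differentiable (fun y => F y 0 k *: delta_mx 0 k : 'rV[K]_m) x.
  exact: differentiableZl.
have FE : F = \sum_k (fun y => F y 0 k *: delta_mx 0 k : 'rV[K]_m).
  by apply/funext => y; rewrite fct_sumE [LHS]row_sum_delta.
split; first by rewrite FE; exact: differentiable_sum.
move=> v; rewrite [in LHS]FE derive_sum => [|k]; last exact: diff_derivable.
rewrite [RHS]row_sum_delta; apply: eq_bigr => k _.
by rewrite !mxE deriveE // diffZl // deriveE.
Qed.

Lemma derive_pair (K : numFieldType) (U V W : normedModType K) (f : U -> V)
    (g : U -> W) (x v : U) : differentiable f x -> differentiable g x ->
  'D_v (fun y => (f y, g y)) x = ('D_v f x, 'D_v g x).
Proof.
move=> df dg; rewrite !deriveE //; last exact: differentiable_pair.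
by rewrite diff_pair.
Qed.

Lemma derive_comp (K : numFieldType) (U V W : normedModType K) (f : U -> V)
    (g : V -> W) (x v : U) : differentiable f x -> differentiable g (f x) ->
  'D_v (g \o f) x = 'D_('D_v f x) g (f x).
Proof.
move=> df dg; rewrite !deriveE //; last exact: differentiable_comp.
by rewrite diff_comp.
Qed.

(** * Derivatives depend only on germs *)

Section Locality.
Variables (R : realType) (n : nat).
Implicit Types (f g : 'rV[R[i]]_n -> R[i]) (z v w : 'rV[R[i]]_n).

Lemma near_ofC (W : set 'rV[R[i]]_n) (P : 'rV[R[i]]_n -> Prop) z :
  open (@ofC R n @` W) -> W z -> (forall w, W w -> P w) ->
  \forall p \near ofC z, P (toC p).
Proof.
move=> oW Wz WP; have : nbhs (ofC z) (@ofC R n @` W).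
  by rewrite nbhsE; exists (@ofC R n @` W) => //; split => //; exists z.
by apply: filterS => _ [w Ww <-]; rewrite ofCK; exact: WP.
Qed.

Lemma eq_rdifferentiable (W : set 'rV[R[i]]_n) f g z :
  open (@ofC R n @` W) -> W z -> (forall w, W w -> f w = g w) ->
  rdifferentiable f z -> rdifferentiable g z.
Proof.
move=> oW Wz fg [fr fi]; have fg' := near_ofC oW Wz fg.
split; [apply: near_eq_differentiable fr | apply: near_eq_differentiable fi];
by apply: filterS fg' => p /= ->.
Qed.

Lemma eq_rderive (W : set 'rV[R[i]]_n) f g v z :
  open (@ofC R n @` W) -> W z -> (forall w, W w -> f w = g w) ->
  rderive v f z = rderive v g z.
Proof.
move=> oW Wz fg; have fg' := near_ofC oW Wz fg.
by congr (_ +i* _); apply: near_eq_derive; apply: filterS fg' => p /= ->.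
Qed.

End Locality.

(** * The chain rule in real coordinates *)

Section ChainRule.
Variables (R : realType) (n m : nat).
Variables (phi : 'rV[R[i]]_n -> 'rV[R[i]]_m) (z : 'rV[R[i]]_n).
Hypothesis dphi : forall k, rdifferentiable (fun w => phi w 0 k) z.

Let Phi (p : 'rV[R]_n * 'rV[R]_n) := ofC (phi (toC p)).

(** [Phi] is [phi] read in real coordinates. Its differential is assembled from those of the real
    and imaginary parts of the entries, and is [rderive_row] read in real coordinates, which reduces
    the complex chain rule to the real one. *)
Let Phi_diff : differentiable Phi (ofC z) /\
  forall v, 'D_(ofC v) Phi (ofC z) = ofC (rderive_row v phi z).
Proof.
pose A p : 'rV[R]_m := \row_k complex.Re (phi (toC p) 0 k).
pose B p : 'rV[R]_m := \row_k complex.Im (phi (toC p) 0 k).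
have AE k : (fun p => A p 0 k) = (fun p => complex.Re (phi (toC p) 0 k)).
  by apply/funext => p; rewrite mxE.
have BE k : (fun p => B p 0 k) = (fun p => complex.Im (phi (toC p) 0 k)).
  by apply/funext => p; rewrite mxE.
have [dA dAE] : differentiable A (ofC z) /\ forall v, 'D_v A (ofC z) =
    \row_k 'D_v (fun y => A y 0 k) (ofC z).
  by apply: differentiable_row => k; rewrite AE; case: (dphi k).
have [dB dBE] : differentiable B (ofC z) /\ forall v, 'D_v B (ofC z) =
    \row_k 'D_v (fun y => B y 0 k) (ofC z).
  by apply: differentiable_row => k; rewrite BE; case: (dphi k).
have -> : Phi = fun p => (A p, B p) by [].
split=> [|v]; first exact: differentiable_pair.
rewrite (derive_pair _ dA dB) dAE dBE.
by congr (_, _); apply/rowP => k; rewrite !mxE ?AE ?BE.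
Qed.

Variable f : 'rV[R[i]]_m -> R[i].
Hypothesis df : rdifferentiable f (phi z).

Let comp_real (F : 'rV[R]_m * 'rV[R]_m -> R) :
  differentiable F (ofC (phi z)) -> differentiable (F \o Phi) (ofC z) /\
  forall v, 'D_(ofC v) (F \o Phi) (ofC z) =
    'D_(ofC (rderive_row v phi z)) F (ofC (phi z)).
Proof.
case: Phi_diff => dP dPE dF.
have PE : Phi (ofC z) = ofC (phi z) by rewrite /Phi ofCK.
rewrite -PE in dF *; split=> [|v]; first exact: differentiable_comp.
by rewrite (derive_comp _ dP dF) dPE.
Qed.

Lemma rdifferentiable_comp : rdifferentiable (fun w => f (phi w)) z.
Proof.
case: df => fr fi; split.
  rewrite (_ : (fun p => _) = (fun p => complex.Re (f (toC p))) \o Phi).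
    by case: (comp_real fr).
  by apply/funext => p; rewrite /Phi /= ofCK.
rewrite (_ : (fun p => _) = (fun p => complex.Im (f (toC p))) \o Phi).
  by case: (comp_real fi).
by apply/funext => p; rewrite /Phi /= ofCK.
Qed.

Lemma rderive_comp v :
  rderive v (fun w => f (phi w)) z = rderive (rderive_row v phi z) f (phi z).
Proof.
case: df => fr fi; rewrite /rderive.
rewrite (_ : (fun p => complex.Re _) =
  (fun p => complex.Re (f (toC p))) \o Phi); last first.
  by apply/funext => p; rewrite /Phi /= ofCK.
rewrite (_ : (fun p => complex.Im (f (phi _))) =
  (fun p => complex.Im (f (toC p))) \o Phi); last first.
  by apply/funext => p; rewrite /Phi /= ofCK.
by rewrite (comp_real fr).2 (comp_real fi).2.
Qed.

End ChainRule.

(* [smooth_on] as the conjunction of the finite orders of differentiability;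
   all closure properties go by induction on the order. *)
Definition smooth_upto (R : realType) n m (W : set 'rV[R[i]]_n)
    (f : 'rV[R[i]]_n -> R[i]) : Prop :=
  forall vs : seq 'rV[R[i]]_n, (size vs <= m)%N -> forall z, W z ->
    rdifferentiable (foldr (@rderive R n) f vs) z.

(** * Smoothness of finite order: sums, products, conjugates and inverses *)

Section Smooth.
Variables (R : realType) (n : nat) (W : set 'rV[R[i]]_n).
Hypothesis oW : open (@ofC R n @` W).
Implicit Types (f g : 'rV[R[i]]_n -> R[i]) (m : nat).

Lemma smooth_onP f : smooth_on W f <-> forall m, smooth_upto m W f.
Proof. by split=> [sf m vs _|sf vs]; [exact: sf | exact: (sf (size vs))]. Qed.

(** [foldr] applies the last direction of the list first, so peeling it off replaces [f] by
    [rderive v f]. This is the form in which the inductions use the Leibniz rule. *)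
Lemma smooth_uptoS m f : smooth_upto m.+1 W f <->
  (forall z, W z -> rdifferentiable f z) /\
  (forall v, smooth_upto m W (rderive v f)).
Proof.
split=> [sf|[df sf] vs].
  split=> [z|v vs vsm]; first exact: (sf [::]).
  by rewrite -foldr_rcons; apply: sf; rewrite size_rcons.
case/lastP: vs => [_|vs v]; first exact: df.
by rewrite size_rcons foldr_rcons => vsm; exact: sf.
Qed.

Lemma smooth_uptoW m f : smooth_upto m.+1 W f -> smooth_upto m W f.
Proof. by move=> sf vs /leqW; exact: sf. Qed.

Lemma eq_smooth_upto m f g : (forall z, W z -> f z = g z) ->
  smooth_upto m W f -> smooth_upto m W g.
Proof.
move=> fg sf vs vsm z Wz; apply: (eq_rdifferentiable oW Wz _ (sf vs vsm z Wz)).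
elim: vs {vsm z Wz} => [|v vs IH] //= w Ww; exact: eq_rderive oW Ww IH.
Qed.

Lemma smooth_upto_cst m (c : R[i]) : smooth_upto m W (fun=> c).
Proof.
elim: m c => [c|m IH c].
  by case=> // _ z _; exact: rdifferentiable_cst.
apply/smooth_uptoS; split=> [z _|v]; first exact: rdifferentiable_cst.
by apply: eq_smooth_upto (IH 0) => z _; rewrite rderive_cst.
Qed.

Lemma smooth_uptoD m f g : smooth_upto m W f -> smooth_upto m W g ->
  smooth_upto m W (fun w => f w + g w).
Proof.
elim: m f g => [|m IH] f g sf sg.
  case=> // _ z Wz.
  by apply: rdifferentiableD; [exact: (sf [::]) | exact: (sg [::])].
case/smooth_uptoS: (sf) => df Df; case/smooth_uptoS: (sg) => dg Dg.
apply/smooth_uptoS; split=> [z Wz|v].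
  by apply: rdifferentiableD; [exact: df | exact: dg].
apply: eq_smooth_upto (IH _ _ (Df v) (Dg v)) => z Wz.
by rewrite rderiveD //; [exact: df | exact: dg].
Qed.

Lemma smooth_uptoM m f g : smooth_upto m W f -> smooth_upto m W g ->
  smooth_upto m W (fun w => f w * g w).
Proof.
elim: m f g => [|m IH] f g sf sg.
  case=> // _ z Wz.
  by apply: rdifferentiableM; [exact: (sf [::]) | exact: (sg [::])].
case/smooth_uptoS: (sf) => df Df; case/smooth_uptoS: (sg) => dg Dg.
apply/smooth_uptoS; split=> [z Wz|v].
  by apply: rdifferentiableM; [exact: df | exact: dg].
apply: eq_smooth_upto (smooth_uptoD (IH _ _ (Df v) (smooth_uptoW sg))
  (IH _ _ (smooth_uptoW sf) (Dg v))) => z Wz.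
by rewrite rderiveM //; [exact: df | exact: dg].
Qed.

Lemma smooth_upto_conj m f : smooth_upto m W f ->
  smooth_upto m W (fun w => Num.conj (f w)).
Proof.
elim: m f => [|m IH] f sf.
  case=> // _ z Wz.
  by apply: rdifferentiable_conj; exact: (sf [::]).
case/smooth_uptoS: (sf) => df Df.
apply/smooth_uptoS; split=> [z Wz|v].
  by apply: rdifferentiable_conj; exact: df.
apply: eq_smooth_upto (IH _ (Df v)) => z Wz.
by rewrite rderive_conj //; exact: df.
Qed.

(** Obtained by differentiating f^-1 f = 1 on the open set [W]. The right-hand side is written as a
    product so that [smooth_uptoM] applies to it directly. *)
Lemma rderiveV v f z : (forall w, W w -> f w != 0) -> W z ->
  rdifferentiable f z ->
  rderive v (fun w => (f w)^-1) z =
  - 1 * (rderive v f z * ((f z)^-1 * (f z)^-1)).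
Proof.
move=> f0 Wz df; have dV := rdifferentiableV df (f0 z Wz).
have fVf w : W w -> (f w)^-1 * f w = 1 by move=> Ww; rewrite mulVf // f0.
have := rderiveM v dV df.
rewrite (eq_rderive v oW Wz fVf) rderive_cst => /esym/eqP.
rewrite addr_eq0 => /eqP E.
apply: (mulIf (f0 z Wz)); rewrite E mulN1r mulNr; congr (- _).
by rewrite -!mulrA mulVf ?f0 // mulr1 mulrC.
Qed.

Lemma smooth_uptoV m f : (forall z, W z -> f z != 0) -> smooth_upto m W f ->
  smooth_upto m W (fun w => (f w)^-1).
Proof.
move=> f0; elim: m => [|m IH] sf.
  case=> // _ z Wz.
  by apply: rdifferentiableV; [exact: (sf [::]) | exact: f0].
case/smooth_uptoS: (sf) => df Df.
have fV := IH (smooth_uptoW sf).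
apply/smooth_uptoS; split=> [z Wz|v].
  by apply: rdifferentiableV; [exact: df | exact: f0].
have sV := smooth_uptoM (smooth_upto_cst (- 1))
  (smooth_uptoM (Df v) (smooth_uptoM fV fV)).
apply: eq_smooth_upto sV => z Wz.
by rewrite rderiveV //; exact: df.
Qed.

End Smooth.

Section DirectionLinearity.
Variables (R : realType) (n : nat).
Variables (f : 'rV[R[i]]_n -> R[i]) (z : 'rV[R[i]]_n).
Hypothesis df : rdifferentiable f z.

Lemma rderive_dirD v w : rderive (v + w) f z = rderive v f z + rderive w f z.
Proof. by have := rderive_linear 1 v w df; rewrite scale1r mul1r. Qed.

Lemma rderive_dir0 : rderive 0 f z = 0.
Proof. by apply: (addrI (rderive 0 f z)); rewrite -rderive_dirD !addr0. Qed.

Lemma rderive_dirZ (a : R) v : rderive (a%:C *: v) f z = a%:C * rderive v f z.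
Proof.
by have := rderive_linear a v 0 df; rewrite addr0 rderive_dir0 addr0.
Qed.

(** The chain rule produces a direction that varies with the point. Expanding it over the real basis
    e_k, i e_k leaves derivatives in fixed directions with smooth coefficients. *)
Lemma rderive_coord w : rderive w f z =
  \sum_k ((complex.Re (w 0 k))%:C * rderive (delta_mx 0 k) f z +
          (complex.Im (w 0 k))%:C * rderive ('i *: delta_mx 0 k) f z).
Proof.
rewrite [in LHS](row_sum_delta w) (big_morph (fun v => rderive v f z)
  rderive_dirD rderive_dir0); apply: eq_bigr => k _.
rewrite -!rderive_dirZ -rderive_dirD scalerA -scalerDl.
by rewrite {1}[w 0 k]complexE [_%:C * 'i]mulrC.
Qed.

End DirectionLinearity.

Section SmoothOn.
Variables (R : realType) (n : nat) (W : set 'rV[R[i]]_n).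
Hypothesis oW : open (@ofC R n @` W).
Implicit Types (f g : 'rV[R[i]]_n -> R[i]).

Lemma smooth_on_diff f z : smooth_on W f -> W z -> rdifferentiable f z.
Proof. by move=> sf; exact: (sf [::]). Qed.

Lemma eq_smooth_on f g : (forall z, W z -> f z = g z) ->
  smooth_on W f -> smooth_on W g.
Proof.
by move=> fg /smooth_onP sf; apply/smooth_onP => m;
  exact: eq_smooth_upto (sf m).
Qed.

Lemma smooth_on_derive v f : smooth_on W f -> smooth_on W (rderive v f).
Proof. by move=> sf vs z Wz; rewrite -foldr_rcons; exact: sf. Qed.

Lemma smooth_on_cst (c : R[i]) : smooth_on W (fun=> c).
Proof. by apply/smooth_onP => m; exact: smooth_upto_cst. Qed.

Lemma smooth_onD f g : smooth_on W f -> smooth_on W g ->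
  smooth_on W (fun w => f w + g w).
Proof.
by move=> /smooth_onP sf /smooth_onP sg; apply/smooth_onP => m;
  exact: smooth_uptoD.
Qed.

Lemma smooth_onM f g : smooth_on W f -> smooth_on W g ->
  smooth_on W (fun w => f w * g w).
Proof.
by move=> /smooth_onP sf /smooth_onP sg; apply/smooth_onP => m;
  exact: smooth_uptoM.
Qed.

Lemma smooth_onV f : (forall z, W z -> f z != 0) -> smooth_on W f ->
  smooth_on W (fun w => (f w)^-1).
Proof.
by move=> f0 /smooth_onP sf; apply/smooth_onP => m; exact: smooth_uptoV.
Qed.

End SmoothOn.

(** * Smoothness of compositions *)

Section SmoothComp.
Variables (R : realType) (n m : nat).
Variables (W : set 'rV[R[i]]_n) (W' : set 'rV[R[i]]_m).
Hypothesis oW : open (@ofC R n @` W).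
Variable phi : 'rV[R[i]]_n -> 'rV[R[i]]_m.
Hypothesis phiW : forall z, W z -> W' (phi z).
Hypothesis sphi : forall k, smooth_on W (fun w => phi w 0 k).

(** Re f = (f + conj f) / 2, and below Im f = (conj f - f) i / 2, so the operations already treated
    suffice. *)
Let smooth_upto_Re l f : smooth_upto l W f ->
  smooth_upto l W (fun w => (complex.Re (f w))%:C).
Proof.
move=> sf; have sR := smooth_uptoM oW
  (smooth_uptoD oW sf (smooth_upto_conj oW sf)) (smooth_upto_cst oW 2^-1).
by apply: (eq_smooth_upto oW _ sR) => z _; rewrite ReJ_add.
Qed.

Let smooth_upto_Im l f : smooth_upto l W f ->
  smooth_upto l W (fun w => (complex.Im (f w))%:C).
Proof.
move=> sf; have sR := smooth_uptoM oW (smooth_uptoD oW (smooth_upto_conj oW sf)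
  (smooth_uptoM oW (smooth_upto_cst oW (- 1)) sf))
  (smooth_upto_cst oW (2^-1 * 'i)).
by apply: (eq_smooth_upto oW _ sR) => z _; rewrite ImJ_sub mulN1r mulrA.
Qed.

Lemma smooth_upto_sum l (I : Type) (s : seq I) (P : pred I)
    (F : I -> 'rV[R[i]]_n -> R[i]) :
  (forall i, smooth_upto l W (F i)) ->
  smooth_upto l W (fun w => \sum_(i <- s | P i) F i w).
Proof.
move=> sF; elim: s => [|i s IH].
  apply: (eq_smooth_upto oW _ (smooth_upto_cst oW 0)) => z _.
  by rewrite big_nil.
case: (boolP (P i)) => Pi.
  apply: (eq_smooth_upto oW _ (smooth_uptoD oW (sF i) IH)) => z _.
  by rewrite big_cons Pi.
by apply: (eq_smooth_upto oW _ IH) => z _; rewrite big_cons (negbTE Pi).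
Qed.

Lemma smooth_upto_comp l f : smooth_upto l W' f ->
  smooth_upto l W (fun w => f (phi w)).
Proof.
have dphi z : W z -> forall k, rdifferentiable (fun w => phi w 0 k) z.
  by move=> Wz k; exact: smooth_on_diff (sphi k) Wz.
elim: l f => [|l IH] f sf.
  case=> // _ z Wz.
  by apply: rdifferentiable_comp; [exact: dphi | exact/(sf [::])/phiW].
case/smooth_uptoS: (sf) => df Df.
apply/smooth_uptoS; split=> [z Wz|v].
  by apply: rdifferentiable_comp; [exact: dphi | exact/df/phiW].
have sp k : smooth_upto l W (fun w => rderive_row v phi w 0 k).
  apply: (@eq_smooth_upto _ _ _ oW _ (rderive v (fun w => phi w 0 k))).
    by move=> z _; rewrite mxE.
  by have /smooth_onP := smooth_on_derive v (sphi k); exact.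
(* The derivative of the composite, expanded by [rderive_coord]: the induction hypothesis applies to
   the derivatives of [f] in fixed directions, composed with [phi]. *)
have sD : smooth_upto l W (fun w => \sum_k
    ((complex.Re (rderive_row v phi w 0 k))%:C *
       rderive (delta_mx 0 k) f (phi w) +
     (complex.Im (rderive_row v phi w 0 k))%:C *
       rderive ('i *: delta_mx 0 k) f (phi w))).
  apply: smooth_upto_sum => k.
  exact: (smooth_uptoD oW
    (smooth_uptoM oW (smooth_upto_Re (sp k)) (IH _ (Df _)))
    (smooth_uptoM oW (smooth_upto_Im (sp k)) (IH _ (Df _)))).
apply: (eq_smooth_upto oW _ sD) => z Wz.
rewrite rderive_comp ?rderive_coord //; [exact/df/phiW | exact: dphi |].
exact/df/phiW.
Qed.

Lemma smooth_on_comp f : smooth_on W' f -> smooth_on W (fun w => f (phi w)).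
Proof.
by move=> /smooth_onP sf; apply/smooth_onP => l; exact: smooth_upto_comp.
Qed.

End SmoothComp.

(** * Functions on a complex manifold *)

Section Manifold.
Variables (R : realType) (n : nat) (X : complexManifold R n).
Implicit Types (i j : chart X) (U V : set X) (F G : X -> R[i]).
Implicit Types (v w : 'rV[R[i]]_n) (x y : X).

(** The image is the preimage of [U] under the inverse chart, which is continuous on the open set
    [D]; it is thus open in [D], hence open. *)
Lemma cmap_image_open U (oU : open U) i :
  open (@ofC R n @` (cmap i @` (U `&` cdom i))).
Proof.
pose D := (@ofC R n \o cmap i) @` cdom i.
have oD : open D by exact: cimage_open.
have /open_subspaceP[S oS SD] :
    open ((cinv i \o @toC R n) @^-1` U : set (subspace D)).
  by have /continuousP := @cinv_continuous R n X i; exact.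
rewrite (_ : _ @` _ = S `&` D); first exact: openI.
rewrite SD; apply/seteqP; split=> [_ [_ [x [Ux ix] <-] <-]|p [/= Up [x ix xp]]].
  by split; [rewrite /= ofCK cmapK | exists x].
exists (cmap i x) => //; exists x => //; split => //.
by move: Up; rewrite -xp /= ofCK cmapK.
Qed.

Arguments cmap_image_open {U} oU i.

Definition mdiff i F x := rdifferentiable (F \o cinv i) (cmap i x).

Definition mderive i v F x := rderive v (F \o cinv i) (cmap i x).

Lemma smooth_fun_mdiff U F i x : smooth_fun U F -> U x -> cdom i x ->
  mdiff i F x.
Proof.
by move=> sF Ux ix; apply: smooth_on_diff (sF i) _; exists x.
Qed.

Lemma eq_mderive U F G i v x : open U -> U x -> cdom i x ->
  (forall y, U y -> F y = G y) -> mderive i v F x = mderive i v G x.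
Proof.
move=> oU Ux ix FG.
apply: (@eq_rderive _ _ (cmap i @` (U `&` cdom i)) _ _ v);
  [exact: cmap_image_open | by exists x |].
by move=> _ [y [Uy iy] <-] /=; rewrite cmapK ?FG.
Qed.

Lemma eq_smooth_fun U F G : open U -> (forall y, U y -> F y = G y) ->
  smooth_fun U F -> smooth_fun U G.
Proof.
move=> oU FG sF i; apply: (eq_smooth_on (cmap_image_open oU i) _ (sF i)).
by move=> _ [y [Uy iy] <-] /=; rewrite cmapK ?FG.
Qed.

Lemma sub_smooth_fun U V F : V `<=` U -> smooth_fun U F -> smooth_fun V F.
Proof.
move=> VU sF i vs _ [x [Vx ix] <-]; apply: sF; exists x => //.
by split => //; exact: VU.
Qed.

(** * Derivatives and smoothness under a change of chart *)

Section ChangeOfChart.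
Variables i j : chart X.
Let Wij := cmap i @` (cdom i `&` cdom j).
Let phi := cmap j \o cinv i.

Let oWij : open (@ofC R n @` Wij).
Proof. by rewrite /Wij setIC; exact/cmap_image_open/cdom_open. Qed.

Let phi_diff x : cdom i x -> cdom j x ->
  forall k, rdifferentiable (fun z => phi z 0 k) (cmap i x).
Proof.
move=> ix jx k; have [sphi _] := chart_holomorphic i j k.
by apply: smooth_on_diff sphi _; exists x.
Qed.

Let phiE x : cdom i x -> phi (cmap i x) = cmap j x.
Proof. by move=> ix; rewrite /phi /= cmapK. Qed.

(** Near x, F in chart [i] is F in chart [j] after the transition map, so this is the chain rule. It
    is the source of the condition [A1_chart] for the constructed forms. *)
Lemma mderive_chart F v x : cdom i x -> cdom j x -> mdiff j F x ->
  mderive i v F x = mderive j (dchart i j x v) F x.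
Proof.
move=> ix jx dF; have Wx : Wij (cmap i x) by exists x.
rewrite /mderive (eq_rderive v oWij Wx (g := fun w => (F \o cinv j) (phi w))).
  by rewrite rderive_comp ?phiE //; exact: phi_diff.
by move=> _ [y [iy jy] <-]; rewrite phiE //= !cmapK.
Qed.

(** Smoothness may be checked in a single chart containing [U]. This is needed for [mderive j v F],
    which is defined through the chart [j] but must be smooth in all charts. *)
Lemma smooth_on_chart U F : open U -> U `<=` cdom j ->
  smooth_on (cmap j @` U) (F \o cinv j) ->
  smooth_on (cmap i @` (U `&` cdom i)) (F \o cinv i).
Proof.
move=> oU Uj sF; have oW := cmap_image_open oU i.
have sphi k : smooth_on (cmap i @` (U `&` cdom i)) (fun z => phi z 0 k).
  have [sphi _] := chart_holomorphic i j k.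
  move=> vs _ [y [Uy iy] <-]; apply: sphi; exists y => //.
  by split => //; exact: Uj.
have phiW z : (cmap i @` (U `&` cdom i)) z -> (cmap j @` U) (phi z).
  by move=> [y [Uy iy] <-]; exists y => //; rewrite phiE.
have sC := smooth_on_comp oW phiW sphi sF.
apply: (eq_smooth_on oW _ sC).
by move=> _ [y [Uy iy] <-]; rewrite phiE //= !cmapK //; exact: Uj.
Qed.

(** The transition maps are holomorphic, so their derivatives commute with multiplication by i;
    hence the splitting into types does not depend on the chart. *)
Lemma dchart_i v x : cdom i x -> cdom j x ->
  dchart i j x ('i *: v) = 'i *: dchart i j x v.
Proof.
move=> ix jx; apply/rowP => k; rewrite !mxE.
by have [_ ->] := chart_holomorphic i j k; last by exists x.
Qed.

End ChangeOfChart.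

Lemma smooth_fun_mderive U F i v : open U -> smooth_fun U F ->
  smooth_fun (U `&` cdom i) (mderive i v F).
Proof.
move=> oU sF j; have oUi : open (U `&` cdom i) by apply/openI/cdom_open.
apply: (@smooth_on_chart j i) => //.
have oW := cmap_image_open oU i.
apply: (eq_smooth_on oW _ (smooth_on_derive v (sF i))).
by move=> _ [y [Uy iy] <-]; rewrite /mderive /= cmapK.
Qed.

Section Operations.
Variable U : set X.
Hypothesis oU : open U.

Let oW i := cmap_image_open oU i.

Lemma smooth_fun_cst (c : R[i]) : smooth_fun U (fun=> c).
Proof. by move=> i; exact: smooth_on_cst. Qed.

Lemma smooth_funD F G : smooth_fun U F -> smooth_fun U G ->
  smooth_fun U (fun x => F x + G x).
Proof. by move=> sF sG i; exact: smooth_onD (sF i) (sG i). Qed.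

Lemma smooth_funM F G : smooth_fun U F -> smooth_fun U G ->
  smooth_fun U (fun x => F x * G x).
Proof. by move=> sF sG i; exact: smooth_onM (sF i) (sG i). Qed.

Lemma smooth_funV F : (forall x, U x -> F x != 0) -> smooth_fun U F ->
  smooth_fun U (fun x => (F x)^-1).
Proof.
move=> F0 sF i; apply: smooth_onV (sF i) => //.
by move=> _ [y [Uy iy] <-] /=; rewrite cmapK ?F0.
Qed.

Lemma smooth_fun_sum (I : Type) (s : seq I) (F : I -> X -> R[i]) :
  (forall k, smooth_fun U (F k)) -> smooth_fun U (fun x => \sum_(k <- s) F k x).
Proof.
move=> sF; elim: s => [|k s IH].
  by apply: (eq_smooth_fun oU _ (smooth_fun_cst 0)) => x _; rewrite big_nil.
apply: (eq_smooth_fun oU _ (smooth_funD (sF k) IH)) => x _.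
by rewrite big_cons.
Qed.

Lemma smooth_fun_prod (I : Type) (s : seq I) (F : I -> X -> R[i]) :
  (forall k, smooth_fun U (F k)) ->
  smooth_fun U (fun x => \prod_(k <- s) F k x).
Proof.
move=> sF; elim: s => [|k s IH].
  by apply: (eq_smooth_fun oU _ (smooth_fun_cst 1)) => x _; rewrite big_nil.
apply: (eq_smooth_fun oU _ (smooth_funM (sF k) IH)) => x _.
by rewrite big_cons.
Qed.

End Operations.

Lemma mderiveD i v F G x : mdiff i F x -> mdiff i G x ->
  mderive i v (fun y => F y + G y) x = mderive i v F x + mderive i v G x.
Proof. exact: rderiveD. Qed.

Lemma mderiveM i v F G x : cdom i x -> mdiff i F x -> mdiff i G x ->
  mderive i v (fun y => F y * G y) x =
  mderive i v F x * G x + F x * mderive i v G x.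
Proof.
move=> ix dF dG; have := rderiveM v dF dG.
by rewrite /mderive /= cmapK.
Qed.

Lemma mderive_conj i v F x : mdiff i F x ->
  mderive i v (fun y => Num.conj (F y)) x = Num.conj (mderive i v F x).
Proof. exact: rderive_conj. Qed.

Lemma mderive_cst i v (c : R[i]) x : mderive i v (fun=> c) x = 0.
Proof. exact: rderive_cst. Qed.

(** Both conclusions are proved together because [mderiveD] needs the tail of the sum to be
    differentiable. *)
Lemma mderive_sum i v (I : Type) (s : seq I) (F : I -> X -> R[i]) x :
  (forall k, mdiff i (F k) x) ->
  mdiff i (fun y => \sum_(k <- s) F k y) x /\
  mderive i v (fun y => \sum_(k <- s) F k y) x =
    \sum_(k <- s) mderive i v (F k) x.
Proof.
move=> dF; elim: s => [|k s [IHd IH]].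
  rewrite (_ : (fun y => _) = fun=> 0); last first.
    by apply/funext => y; rewrite big_nil.
  by rewrite mderive_cst big_nil; split => //; exact: rdifferentiable_cst.
rewrite (_ : (fun y => _) = fun y => F k y + \sum_(k <- s) F k y); last first.
  by apply/funext => y; rewrite big_cons.
by rewrite mderiveD // big_cons IH; split => //;
  exact: (rdifferentiableD (dF k) IHd).
Qed.

Lemma holomorphic_fun_i U F i v x : holomorphic_fun U F -> U x -> cdom i x ->
  mderive i ('i *: v) F x = 'i * mderive i v F x.
Proof. by move=> hF Ux ix; apply: (hF i).2; exists x. Qed.

Lemma holomorphic_smooth U F : holomorphic_fun U F -> smooth_fun U F.
Proof. by move=> hF i; exact: (hF i).1. Qed.

End Manifold.

(** * Conjugate transposes *)

Local Notation "M ^H" := (map_mx Num.conj M)^T (at level 8, format "M ^H").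

Lemma conj_i (R : realType) : Num.conj ('i : R[i]) = - 'i.
Proof. by apply/eqP; rewrite eq_complex /= oppr0 !eqxx. Qed.

Lemma mul_ii (R : realType) : 'i * 'i = - 1 :> R[i].
Proof. by rewrite -expr2 sqr_i. Qed.

Section ConjugateTranspose.
Variable R : realType.

Lemma mulmx_conjT m p q (A : 'M[R[i]]_(m, p)) (B : 'M[R[i]]_(p, q)) :
  (A *m B)^H = B^H *m A^H.
Proof. by rewrite map_mxM trmx_mul. Qed.

Lemma conjT_D m p (A B : 'M[R[i]]_(m, p)) : (A + B)^H = A^H + B^H.
Proof. by apply/matrixP => k l; rewrite !mxE rmorphD. Qed.

Lemma conjT_B m p (A B : 'M[R[i]]_(m, p)) : (A - B)^H = A^H - B^H.
Proof. by apply/matrixP => k l; rewrite !mxE rmorphB. Qed.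

Lemma conjT_Z m p (c : R[i]) (A : 'M[R[i]]_(m, p)) :
  (c *: A)^H = Num.conj c *: A^H.
Proof. by apply/matrixP => k l; rewrite !mxE rmorphM. Qed.

Lemma half2 p q (A : 'M[R[i]]_(p, q)) : 2^-1 *: (A + A) = A.
Proof.
by rewrite -{1 2}[A]scale1r -scalerDl scalerA mulVf ?scale1r // pnatr_eq0.
Qed.

(** With A = dH(v) and B = dH(i v) this is d H = del H + (del H)^*: the matrix i B is anti-Hermitian
    and cancels, while A is counted twice. *)
Lemma hermitian_half p (A B : 'M[R[i]]_p) : A^H = A -> B^H = B ->
  2^-1 *: (A - 'i *: B) + (2^-1 *: (A - 'i *: B))^H = A.
Proof.
move=> AH BH; rewrite conjT_Z conjT_B conjT_Z AH BH conj_i scaleNr opprK.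
have -> : Num.conj (2^-1 : R[i]) = 2^-1 by rewrite fmorphV rmorph_nat.
by rewrite -scalerDr addrACA addNr addr0 half2.
Qed.

Lemma mx_linE m p (c : R[i]) (A B : 'M[R[i]]_(m, p)) k l :
  (c *: A + B) k l = c * A k l + B k l.
Proof. by rewrite !mxE. Qed.

End ConjugateTranspose.

(** * Matrix-valued functions and the operator del *)

Section MatrixFunctions.
Variables (R : realType) (n : nat) (X : complexManifold R n).
Implicit Types (i j : chart X) (U V : set X).
Implicit Types (v w : 'rV[R[i]]_n) (x y : X).

Definition smooth_mx p q U (F : X -> 'M[R[i]]_(p, q)) :=
  forall k l, smooth_fun U (fun x => F x k l).

Definition mxdiff p q i (F : X -> 'M[R[i]]_(p, q)) x :=
  forall k l, mdiff i (fun y => F y k l) x.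

Definition mxderive p q i v (F : X -> 'M[R[i]]_(p, q)) x : 'M[R[i]]_(p, q) :=
  \matrix_(k, l) mderive i v (fun y => F y k l) x.

Lemma mxderiveE p q i v (F : X -> 'M[R[i]]_(p, q)) x k l :
  mxderive i v F x k l = mderive i v (fun y => F y k l) x.
Proof. exact: mxE. Qed.

(* The (1,0)-part of the differential. *)
Definition mxdel p q i v (F : X -> 'M[R[i]]_(p, q)) x : 'M[R[i]]_(p, q) :=
  2^-1 *: (mxderive i v F x - 'i *: mxderive i ('i *: v) F x).

Definition holomorphic_mx p q U (F : X -> 'M[R[i]]_(p, q)) :=
  forall k l, holomorphic_fun U (fun x => F x k l).

Lemma holomorphic_smooth_mx p q U (F : X -> 'M[R[i]]_(p, q)) :
  holomorphic_mx U F -> smooth_mx U F.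
Proof. by move=> hF k l; exact: holomorphic_smooth. Qed.

Lemma smooth_mxdiff p q U (F : X -> 'M[R[i]]_(p, q)) i x :
  smooth_mx U F -> U x -> cdom i x -> mxdiff i F x.
Proof. by move=> sF Ux ix k l; exact: smooth_fun_mdiff (sF k l) Ux ix. Qed.

Section Pointwise.
Variables (i : chart X) (x : X).
Hypothesis ix : cdom i x.

Lemma eq_mxderive p q U (F G : X -> 'M[R[i]]_(p, q)) v : open U -> U x ->
  (forall y, U y -> F y = G y) -> mxderive i v F x = mxderive i v G x.
Proof.
move=> oU Ux FG; apply/matrixP => k l; rewrite !mxE.
by apply: (eq_mderive v oU Ux ix) => y Uy; rewrite FG.
Qed.

Lemma eq_mxdel p q U (F G : X -> 'M[R[i]]_(p, q)) v : open U -> U x ->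
  (forall y, U y -> F y = G y) -> mxdel i v F x = mxdel i v G x.
Proof.
by move=> oU Ux FG; rewrite /mxdel !(eq_mxderive _ oU Ux FG).
Qed.

Lemma mxderiveD p q (F G : X -> 'M[R[i]]_(p, q)) v :
  mxdiff i F x -> mxdiff i G x ->
  mxderive i v (fun y => F y + G y) x = mxderive i v F x + mxderive i v G x.
Proof.
move=> dF dG; apply/matrixP => k l; rewrite !mxE -mderiveD //.
by congr (mderive i v _ x); apply/funext => y; rewrite mxE.
Qed.

Lemma mxdiffM p q r (F : X -> 'M[R[i]]_(p, q)) (G : X -> 'M[R[i]]_(q, r)) :
  mxdiff i F x -> mxdiff i G x -> mxdiff i (fun y => F y *m G y) x.
Proof.
move=> dF dG k l.
rewrite (_ : (fun y => _) = fun y => \sum_a F y k a * G y a l); last first.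
  by apply/funext => y; rewrite mxE.
have dFG a : mdiff i (fun y => F y k a * G y a l) x.
  exact: (rdifferentiableM (dF k a) (dG a l)).
by have [] := mderive_sum 0 (index_enum 'I_q) dFG.
Qed.

Lemma mxderiveM p q r (F : X -> 'M[R[i]]_(p, q)) (G : X -> 'M[R[i]]_(q, r)) v :
  mxdiff i F x -> mxdiff i G x ->
  mxderive i v (fun y => F y *m G y) x =
  mxderive i v F x *m G x + F x *m mxderive i v G x.
Proof.
move=> dF dG; apply/matrixP => k l; rewrite !mxE.
rewrite (_ : (fun y => _) = fun y => \sum_a F y k a * G y a l); last first.
  by apply/funext => y; rewrite mxE.
have dFG a : mdiff i (fun y => F y k a * G y a l) x.
  exact: (rdifferentiableM (dF k a) (dG a l)).
have [_ ->] := mderive_sum v (index_enum 'I_q) dFG.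
rewrite -big_split /=; apply: eq_bigr => a _.
by rewrite mderiveM // !mxE.
Qed.

Lemma mxdelM p q r (F : X -> 'M[R[i]]_(p, q)) (G : X -> 'M[R[i]]_(q, r)) v :
  mxdiff i F x -> mxdiff i G x ->
  mxdel i v (fun y => F y *m G y) x =
  mxdel i v F x *m G x + F x *m mxdel i v G x.
Proof.
move=> dF dG; rewrite /mxdel !mxderiveM // (scalerDr 'i) opprD addrACA scalerDr.
by rewrite -scalemxAl -scalemxAr mulmxBl mulmxBr -scalemxAl -scalemxAr.
Qed.

Lemma mxdiff_conjT p q (F : X -> 'M[R[i]]_(p, q)) :
  mxdiff i F x -> mxdiff i (fun y => (F y)^H) x.
Proof.
move=> dF k l; rewrite (_ : (fun y => _) = fun y => Num.conj (F y l k)).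
  exact: (rdifferentiable_conj (dF l k)).
by apply/funext => y; rewrite !mxE.
Qed.

Lemma mxderive_conjT p q (F : X -> 'M[R[i]]_(p, q)) v : mxdiff i F x ->
  mxderive i v (fun y => (F y)^H) x = (mxderive i v F x)^H.
Proof.
move=> dF; apply/matrixP => k l; rewrite !mxE -mderive_conj //.
by congr (mderive i v _ x); apply/funext => y; rewrite !mxE.
Qed.

Lemma mxderive_linear p q (F : X -> 'M[R[i]]_(p, q)) (a : R) v w :
  mxdiff i F x ->
  mxderive i (a%:C *: v + w) F x = a%:C *: mxderive i v F x + mxderive i w F x.
Proof.
move=> dF; apply/matrixP => k l.
apply/(etrans (mxderiveE _ _ _ _ _ _))/(etrans (rderive_linear _ _ _ (dF k l))).
apply/esym/(etrans (mx_linE _ _ _ _ _)).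
by congr (_ * _ + _); exact: mxderiveE.
Qed.

Lemma mxderive_dirN p q (F : X -> 'M[R[i]]_(p, q)) v : mxdiff i F x ->
  mxderive i (- v) F x = - mxderive i v F x.
Proof.
move=> dF; apply/matrixP => k l; rewrite !mxE -mulN1r -scaleN1r.
have -> : (- 1 : R[i]) = (- 1 : R)%:C by rewrite rmorphN1.
exact: (rderive_dirZ (dF k l)).
Qed.

Lemma mxdel_linear p q (F : X -> 'M[R[i]]_(p, q)) (a : R) v w :
  mxdiff i F x ->
  mxdel i (a%:C *: v + w) F x = a%:C *: mxdel i v F x + mxdel i w F x.
Proof.
move=> dF; rewrite /mxdel.
have -> : 'i *: (a%:C *: v + w) = a%:C *: ('i *: v) + 'i *: w.
  by rewrite scalerDr !scalerA mulrC.
rewrite !mxderive_linear //.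
move: (mxderive _ _ _ _) (mxderive _ _ _ _).
move: (mxderive _ _ _ _) (mxderive _ _ _ _).
move: (2^-1 : R[i]) (a%:C) ('i : R[i]) => c b d A B C D.
by apply/matrixP => k l; rewrite !mxE; ring.
Qed.

(** This is the statement that del F has type (1,0); it follows from i(i v) = - v. *)
Lemma mxdel_dir_i p q (F : X -> 'M[R[i]]_(p, q)) v : mxdiff i F x ->
  mxdel i ('i *: v) F x = 'i *: mxdel i v F x.
Proof.
move=> dF; rewrite /mxdel [in RHS]scalerA [_ * 2^-1]mulrC -[in RHS]scalerA.
congr (_ *: _); rewrite scalerA mul_ii scaleN1r mxderive_dirN //.
rewrite scalerBr scalerA mul_ii scaleN1r scalerN opprK.
by rewrite [RHS]addrC opprK addrC.
Qed.

Lemma mxderive_chart p q j (F : X -> 'M[R[i]]_(p, q)) v :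
  cdom j x -> mxdiff j F x ->
  mxderive i v F x = mxderive j (dchart i j x v) F x.
Proof.
by move=> jx dF; apply/matrixP => k l; rewrite !mxE; exact: mderive_chart.
Qed.

Lemma mxdel_chart p q j (F : X -> 'M[R[i]]_(p, q)) v :
  cdom j x -> mxdiff j F x -> mxdel i v F x = mxdel j (dchart i j x v) F x.
Proof.
by move=> jx dF; rewrite /mxdel !(mxderive_chart _ jx dF) dchart_i.
Qed.

Lemma holomorphic_mxderive_i p q U (F : X -> 'M[R[i]]_(p, q)) v :
  holomorphic_mx U F -> U x ->
  mxderive i ('i *: v) F x = 'i *: mxderive i v F x.
Proof.
move=> hF Ux; apply/matrixP => k l; rewrite !mxE.
exact: holomorphic_fun_i (hF k l) Ux ix.
Qed.

Lemma holomorphic_mxdel p q U (F : X -> 'M[R[i]]_(p, q)) v :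
  holomorphic_mx U F -> U x -> mxdel i v F x = mxderive i v F x.
Proof.
move=> hF Ux; rewrite /mxdel (holomorphic_mxderive_i _ hF Ux) scalerA mul_ii.
by rewrite scaleN1r opprK half2.
Qed.

(** Conjugation turns complex linearity of d F into antilinearity, and the (1,0)-part of an
    antilinear form is zero. *)
Lemma holomorphic_mxdel_conjT p q U (F : X -> 'M[R[i]]_(p, q)) v :
  holomorphic_mx U F -> U x -> mxdel i v (fun y => (F y)^H) x = 0.
Proof.
move=> hF Ux; have dF := smooth_mxdiff (holomorphic_smooth_mx hF) Ux ix.
rewrite /mxdel !mxderive_conjT // (holomorphic_mxderive_i _ hF Ux) conjT_Z.
by rewrite conj_i scalerA mulrN mul_ii opprK scale1r subrr scaler0.
Qed.

Lemma mxdel_hermitian p U (F : X -> 'M[R[i]]_p) v :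
  open U -> U x -> mxdiff i F x -> (forall y, U y -> (F y)^H = F y) ->
  mxdel i v F x + (mxdel i v F x)^H = mxderive i v F x.
Proof.
move=> oU Ux dF FH.
have E w : (mxderive i w F x)^H = mxderive i w F x.
  by rewrite -mxderive_conjT //; exact: eq_mxderive oU Ux FH.
exact: hermitian_half.
Qed.

End Pointwise.

Section Smoothness.
Variable U : set X.
Hypothesis oU : open U.

Lemma eq_smooth_mx p q (F G : X -> 'M[R[i]]_(p, q)) :
  (forall x, U x -> F x = G x) -> smooth_mx U F -> smooth_mx U G.
Proof.
by move=> FG sF k l; apply: (eq_smooth_fun oU _ (sF k l)) => x Ux; rewrite FG.
Qed.

Lemma smooth_mxD p q (F G : X -> 'M[R[i]]_(p, q)) :
  smooth_mx U F -> smooth_mx U G -> smooth_mx U (fun x => F x + G x).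
Proof.
move=> sF sG k l.
apply: (eq_smooth_fun oU _ (smooth_funD oU (sF k l) (sG k l))).
by move=> x _; rewrite mxE.
Qed.

Lemma smooth_mxZ p q (f : X -> R[i]) (F : X -> 'M[R[i]]_(p, q)) :
  smooth_fun U f -> smooth_mx U F -> smooth_mx U (fun x => f x *: F x).
Proof.
move=> sf sF k l; apply: (eq_smooth_fun oU _ (smooth_funM oU sf (sF k l))).
by move=> x _; rewrite mxE.
Qed.

Lemma smooth_mxM p q r (F : X -> 'M[R[i]]_(p, q)) (G : X -> 'M[R[i]]_(q, r)) :
  smooth_mx U F -> smooth_mx U G -> smooth_mx U (fun x => F x *m G x).
Proof.
move=> sF sG k l.
have sS := smooth_fun_sum oU (index_enum 'I_q)
  (fun a => smooth_funM oU (sF k a) (sG a l)).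
by apply: (eq_smooth_fun oU _ sS) => x _; rewrite mxE.
Qed.

Lemma smooth_fun_det p (F : X -> 'M[R[i]]_p) :
  smooth_mx U F -> smooth_fun U (fun x => \det (F x)).
Proof.
move=> sF; have sS := smooth_fun_sum oU (index_enum {perm 'I_p})
  (fun s : {perm 'I_p} => smooth_funM oU (smooth_fun_cst oU ((-1) ^+ s))
    (smooth_fun_prod oU (index_enum 'I_p) (fun k => sF k (s k)))).
exact: (eq_smooth_fun oU _ sS).
Qed.

(** Cramer's rule: the entries of the inverse are minors, polynomial in the entries of F, divided by
    the nonvanishing determinant. *)
Lemma smooth_mx_inv p (F : X -> 'M[R[i]]_p) :
  (forall x, U x -> F x \in unitmx) -> smooth_mx U F ->
  smooth_mx U (fun x => invmx (F x)).
Proof.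
move=> uF sF; have sA : smooth_mx U (fun x => \adj (F x)).
  move=> k l; have sm : smooth_mx U (fun x => row' l (col' k (F x))).
    move=> a b; apply: (eq_smooth_fun oU _ (sF (lift l a) (lift k b))) => x _.
    by rewrite !mxE.
  have sC := smooth_funM oU (smooth_fun_cst oU ((-1) ^+ (l + k)))
    (smooth_fun_det sm).
  by apply: (eq_smooth_fun oU _ sC) => x _; rewrite mxE.
have d0 x : U x -> \det (F x) != 0 by move=> /uF; rewrite unitmxE unitfE.
apply: (eq_smooth_mx _ (smooth_mxZ (smooth_funV oU d0 (smooth_fun_det sF)) sA)).
by move=> x /uF uFx; rewrite /invmx uFx.
Qed.

End Smoothness.

Lemma smooth_mxderive p q U i v (F : X -> 'M[R[i]]_(p, q)) : open U ->
  smooth_mx U F -> smooth_mx (U `&` cdom i) (mxderive i v F).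
Proof.
move=> oU sF k l; have oUi : open (U `&` cdom i) by apply/openI/cdom_open.
have sD := @smooth_fun_mderive _ _ _ _ _ i v oU (sF k l).
by apply: (eq_smooth_fun oUi _ sD) => x _; rewrite mxderiveE.
Qed.

Arguments smooth_mxderive {p q U} i v {F}.

Lemma smooth_mxdel p q U i v (F : X -> 'M[R[i]]_(p, q)) : open U ->
  smooth_mx U F -> smooth_mx (U `&` cdom i) (mxdel i v F).
Proof.
move=> oU sF; have oUi : open (U `&` cdom i) by apply/openI/cdom_open.
have c (c : R[i]) := smooth_fun_cst oUi c.
have s2 := smooth_mxZ oUi (c (- 'i)) (smooth_mxderive i ('i *: v) oU sF).
have s3 := smooth_mxZ oUi (c 2^-1)
  (smooth_mxD oUi (smooth_mxderive i v oU sF) s2).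
by apply: (eq_smooth_mx oUi _ s3) => x _; rewrite scaleNr.
Qed.

End MatrixFunctions.

Arguments smooth_mxderive {R n X p q U} i v {F}.
Arguments smooth_mxdel {R n X p q U} i v {F}.

(** * The Chern connection in a holomorphic frame *)

Section ChernFormula.
Variables (R : realType) (n r : nat) (X : complexManifold R n).
Implicit Types (i j : chart X) (U V : set X).
Implicit Types (v w : 'rV[R[i]]_n) (x y : X).
Implicit Types (H : X -> 'M[R[i]]_r) (s t : X -> 'rV[R[i]]_r).

(* The Chern connection in a holomorphic frame with Gram matrix H, applied to
   the section with components s: the connection matrix is (del H) H^-1. *)
Definition chern i v H s x : 'rV[R[i]]_r :=
  mxderive i v s x + s x *m mxdel i v H x *m invmx (H x).

Section Pointwise.
Variables (i : chart X) (x : X).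
Hypothesis ix : cdom i x.

Lemma eq_chern U v H s t : open U -> U x -> (forall y, U y -> s y = t y) ->
  chern i v H s x = chern i v H t x.
Proof.
by move=> oU Ux st; rewrite /chern (eq_mxderive ix v oU Ux st) st.
Qed.

Lemma chern_linear H s (a : R) v w : mxdiff i s x -> mxdiff i H x ->
  chern i (a%:C *: v + w) H s x = a%:C *: chern i v H s x + chern i w H s x.
Proof.
move=> ds dH; rewrite /chern mxderive_linear // mxdel_linear //.
by rewrite mulmxDr mulmxDl -scalemxAr -scalemxAl scalerDr addrACA.
Qed.

Lemma chern_chart j v H s : cdom j x -> mxdiff j s x -> mxdiff j H x ->
  chern i v H s x = chern j (dchart i j x v) H s x.
Proof.
move=> jx ds dH; rewrite /chern (mxderive_chart ix v jx ds).
by rewrite (mxdel_chart ix v jx dH).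
Qed.

Lemma chern_leibniz v H s (f : X -> R[i]) : mdiff i f x -> mxdiff i s x ->
  chern i v H (fun y => f y *: s y) x =
  mderive i v f x *: s x + f x *: chern i v H s x.
Proof.
move=> df ds; rewrite /chern scalerDr addrA -!scalemxAl; congr (_ + _).
apply/rowP => k; rewrite !mxE -(mderiveM v ix df (ds 0 k)).
by congr (mderive i v _ x); apply/funext => y; rewrite mxE.
Qed.

Lemma chernD v H s t : mxdiff i s x -> mxdiff i t x ->
  chern i v H (fun y => s y + t y) x = chern i v H s x + chern i v H t x.
Proof.
by move=> ds dt; rewrite /chern mxderiveD // !mulmxDl addrACA.
Qed.

(** Replacing v by i v multiplies [mxdel] by i, so the two terms with the connection matrix cancel
    by 1 + i^2 = 0 and dbar s remains. *)
Lemma chern_form01 v H s : mxdiff i H x ->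
  2^-1 *: (chern i v H s x + 'i *: chern i ('i *: v) H s x) =
  2^-1 *: (mxderive i v s x + 'i *: mxderive i ('i *: v) s x).
Proof.
have cancel (D D' u : 'rV[R[i]]_r) (P P' K : 'M[R[i]]_r) : P' = 'i *: P ->
    D + u *m P *m K + 'i *: (D' + u *m P' *m K) = D + 'i *: D'.
  move=> ->; rewrite scalerDr addrACA -scalemxAr -scalemxAl scalerA mul_ii.
  by rewrite scaleN1r subrr addr0.
move=> dH; congr (_ *: _); rewrite /chern; apply: cancel.
exact: mxdel_dir_i.
Qed.

Lemma chern_metric U v H s t : open U -> U x ->
  mxdiff i s x -> mxdiff i t x -> mxdiff i H x ->
  (forall y, U y -> (H y)^H = H y) -> H x \in unitmx ->
  mxderive i v (fun y => s y *m H y *m (t y)^H) x =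
  chern i v H s x *m H x *m (t x)^H + s x *m H x *m (chern i v H t x)^H.
Proof.
have product (u u' w w' : 'rV[R[i]]_r) (K P Q : 'M[R[i]]_r) :
    K^H = K -> K \in unitmx -> P + P^H = Q ->
    (u' *m K + u *m Q) *m w^H + u *m K *m w'^H =
    (u' + u *m P *m invmx K) *m K *m w^H +
    u *m K *m (w' + w *m P *m invmx K)^H.
  move=> KH uK <-.
  have KVH : (invmx K)^H = invmx K by rewrite map_invmx trmx_inv KH.
  have E : K *m (w' + w *m P *m invmx K)^H = K *m w'^H + P^H *m w^H.
    by rewrite conjT_D !mulmx_conjT KVH (mulmxDr K) (mulKVmx uK).
  rewrite (mulmxDl u') (mulmxKV uK) -!(mulmxA u K) E.
  move: (P^H) (w^H) (w'^H) => P' z z'.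
  rewrite (mulmxDr u P) addrA (mulmxDl (u' *m K + u *m P)).
  rewrite (mulmxDr u (K *m z')) -(mulmxA u P' z) -addrA; congr (_ + _).
  exact: addrC.
move=> oU Ux ds dt dH HH uH.
have E1 := mxderiveM ix v (mxdiffM ds dH) (mxdiff_conjT dt).
have E2 := mxderiveM ix v ds dH.
have E3 := mxderive_conjT v dt.
rewrite E1 E2 E3; apply: product => //; first exact: HH.
exact: mxdel_hermitian HH.
Qed.

Lemma chern_gauge U v H H' s (g : X -> 'M[R[i]]_r) : open U -> U x ->
  mxdiff i s x -> mxdiff i H' x -> holomorphic_mx U g ->
  (forall y, U y -> H y = g y *m H' y *m (g y)^H) -> H x \in unitmx ->
  chern i v H' (fun y => s y *m g y) x = chern i v H s x *m g x.
Proof.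
move=> oU Ux ds dH' hg HE uH.
have dg : mxdiff i g x := smooth_mxdiff (holomorphic_smooth_mx hg) Ux ix.
have dgH := mxdiff_conjT dg.
(* Here A is g, A' is d g = del g, K is H' and P is del H'. Since del g^* = 0, the matrix del H is
   (A' K + A P) A^*. *)
have transform (u u' : 'rV[R[i]]_r) (A A' K P : 'M[R[i]]_r) :
    A *m K *m A^H \in unitmx ->
    u' *m A + u *m A' + u *m A *m P *m invmx K =
    (u' + u *m ((A' *m K + A *m P) *m A^H) *m invmx (A *m K *m A^H)) *m A.
  (* Invertibility of g and of H' is extracted from that of H = g H' g^*. The key identity is then
     g^* H^-1 g = H'^-1. *)
  rewrite !unitmx_mul => /andP[/andP[uA uK] uAH].
  have VE : A^H *m invmx (A *m K *m A^H) *m A = invmx K.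
    have uAK : A *m K *m A^H \in unitmx by rewrite !unitmx_mul uA uK uAH.
    apply: (can_inj (mulKmx uK)); apply: (can_inj (mulKmx uA)).
    by rewrite !mulmxA (mulmxV uAK) mul1mx (mulmxK uK).
  have E (B M : 'M[R[i]]_r) :
      u *m (B *m A^H) *m M *m A = u *m (B *m (A^H *m M *m A)).
    by rewrite !mulmxA.
  rewrite (mulmxDl u') E VE -addrA; congr (_ + _).
  by rewrite (mulmxDl (A' *m K)) (mulmxK uK) mulmxDr !mulmxA.
have E1 := mxderiveM ix v ds dg.
have E2 := eq_mxdel ix v oU Ux HE.
have E3 := mxdelM ix v (mxdiffM dg dH') dgH.
have E4 := mxdelM ix v dg dH'.
have E5 := holomorphic_mxdel ix v hg Ux.
have E6 := holomorphic_mxdel_conjT ix v hg Ux.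
rewrite /chern E1 E2 E3 E6 mulmx0 addr0 E4 E5 (HE _ Ux).
by apply: transform; rewrite -HE.
Qed.

End Pointwise.

Lemma smooth_chern U i v H s : open U -> smooth_mx U s -> smooth_mx U H ->
  (forall x, U x -> H x \in unitmx) ->
  smooth_mx (U `&` cdom i) (chern i v H s).
Proof.
move=> oU ss sH uH; have oUi : open (U `&` cdom i) by apply/openI/cdom_open.
have sub p q (F : X -> 'M[R[i]]_(p, q)) :
    smooth_mx U F -> smooth_mx (U `&` cdom i) F.
  by move=> sF k l; apply: sub_smooth_fun (sF k l) => ? [].
apply: (smooth_mxD oUi (smooth_mxderive i v oU ss)).
apply: (smooth_mxM oUi _ (sub _ _ _ (smooth_mx_inv oU uH sH))).
exact: (smooth_mxM oUi (sub _ _ _ ss) (smooth_mxdel i v oU sH)).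
Qed.

End ChernFormula.

Arguments smooth_chern {R n r X U} i v {H s}.

(** * Frames and Gram matrices *)

Section HermitianForm.
Variables (R : realType) (V : lmodType R[i]) (f : {dot V for @Num.conj R[i]}).
Implicit Types u w e : V.

Lemma dotDl u w e : f (u + w) e = f u e + f w e.
Proof. exact: linearDl. Qed.

Lemma dotZl (c : R[i]) u e : f (c *: u) e = c * f u e.
Proof. exact: linearZl_LR. Qed.

Lemma dotDr u w e : f e (u + w) = f e u + f e w.
Proof. exact: linearDr. Qed.

Lemma dotZr (c : R[i]) u e : f e (c *: u) = Num.conj c * f e u.
Proof. exact: linearZr_LR. Qed.

Lemma dot_conj u e : Num.conj (f u e) = f e u.
Proof. by rewrite [in RHS]hermC /= expr0 mul1r. Qed.

Lemma dot_nondegenerate u : f u u = 0 -> u = 0.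
Proof. by move=> /eqP; rewrite dnorm_eq0 => /eqP. Qed.

End HermitianForm.

Lemma ext0E (T : Type) (U : set T) (F : T -> zmodType)
    (s : forall x, U x -> F x) x (Ux : U x) : ext0 s x = s x Ux.
Proof.
by rewrite /ext0; case: pselect => // Ux'; rewrite (Prop_irrelevance Ux' Ux).
Qed.

(** * Trivializations, their frames and the matrix of h *)

Section Bundle.
Variables (R : realType) (n r : nat) (X : complexManifold R n).
Variable E : holomorphicBundle X r.
Implicit Types (i j : chart X) (U V : set X) (a b : trivialization E).
Implicit Types (v w : 'rV[R[i]]_n) (x y : X).

(** [triv_bij] only asserts that an inverse exists, and only over [tdom a]; choosing a preimage,
    with default 0, gives an operation defined at every x. *)
Definition tinv a x (u : 'rV[R[i]]_r) : E x := xget 0 [set e | triv a x e = u].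

Lemma tinvK a x u : tdom a x -> triv a x (tinv a x u) = u.
Proof.
move=> /(@triv_bij _ _ _ _ E a x)[g gK Kg].
by rewrite /tinv; case: xgetP => [e _ //|/(_ (g u))]; rewrite /= Kg.
Qed.

Lemma triv_inj a x : tdom a x -> injective (triv a x).
Proof. by move=> /(@triv_bij _ _ _ _ E a x)/bij_inj. Qed.

Lemma trivK a x (e : E x) : tdom a x -> tinv a x (triv a x e) = e.
Proof. by move=> ax; apply: (triv_inj ax); rewrite tinvK. Qed.

Definition components a U (s : local_section E U) x : 'rV[R[i]]_r :=
  triv a x (ext0 s x).

Lemma componentsE a U (s : local_section E U) x (Ux : U x) :
  components a s x = triv a x (s x Ux).
Proof. by rewrite /components ext0E. Qed.

Lemma smooth_components a U (s : local_section E U) :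
  smooth_section s -> smooth_mx (U `&` tdom a) (components a s).
Proof. by move=> ss k l; rewrite (ord1 k); exact: ss. Qed.

Lemma transition a b : exists g : X -> 'M[R[i]]_r,
  holomorphic_mx (tdom a `&` tdom b) g /\
  forall x (e : E x), tdom a x -> tdom b x -> triv b x e = triv a x e *m g x.
Proof. exact: triv_holomorphic. Qed.

(** Smoothness in one trivialization is enough: the components in another one are obtained by
    multiplying with the holomorphic matrix g. *)
Lemma smooth_section_tinv a U (s : X -> 'rV[R[i]]_r) (t : local_section E U) :
  open U -> U `<=` tdom a -> smooth_mx U s ->
  (forall x (Ux : U x), t x Ux = tinv a x (s x)) -> smooth_section t.
Proof.
move=> oU Ua ss ts b k; have [g [hg gE]] := transition a b.
have oUb : open (U `&` tdom b) by exact/openI/tdom_open.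
have sg : smooth_mx (U `&` tdom b) g.
  move=> p q; apply: sub_smooth_fun (holomorphic_smooth_mx hg p q) => x [Ux bx].
  by split => //; exact: Ua.
have sU : smooth_mx (U `&` tdom b) s.
  by move=> p q; apply: sub_smooth_fun (ss p q) => x [].
apply: (eq_smooth_fun oUb _ (smooth_mxM oUb sU sg 0 k)) => x [Ux bx].
by rewrite (ext0E _ Ux) ts (gE x _ (Ua x Ux) bx) tinvK //; exact: Ua.
Qed.

(** In the trivialization [b], the components of the frame vector number [l] of [a] form the row [l]
    of the transition matrix, which is holomorphic. *)
Lemma holomorphic_section_frame a U (t : local_section E U) l :
  open U -> U `<=` tdom a ->
  (forall x (Ux : U x), t x Ux = tinv a x (delta_mx 0 l)) ->
  holomorphic_section t.
Proof.
move=> oU Ua ts b k; have [g [hg gE]] := transition a b.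
have oUb : open (U `&` tdom b) by exact/openI/tdom_open.
have tE x : (U `&` tdom b) x -> triv b x (ext0 t x) 0 k = g x l k.
  move=> [Ux bx]; rewrite (ext0E _ Ux) ts (gE x _ (Ua x Ux) bx).
  rewrite tinvK; last exact: Ua.
  by rewrite -rowE mxE.
have hgU : holomorphic_fun (U `&` tdom b) (fun x => g x l k).
  move=> i; have [sg cg] := hg l k i; split.
    move=> vs _ [x [[Ux bx] ix] <-]; apply: sg; exists x => //; split => //.
    by split => //; exact: Ua.
  move=> z v [x [[Ux bx] ix] <-]; apply: cg; exists x => //; split => //.
  by split => //; exact: Ua.
move=> i; split.
  apply: (@eq_smooth_fun _ _ _ _ (fun x => g x l k)) => //.
    by move=> x xU; rewrite tE.
  exact: holomorphic_smooth hgU.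
move=> _ v [x [Ubx ix] <-].
have D w : mderive i w (fun x => triv b x (ext0 t x) 0 k) x =
    mderive i w (fun x => g x l k) x := eq_mderive w oUb Ubx ix tE.
have Di : mderive i ('i *: v) (fun x => triv b x (ext0 t x) 0 k) x =
    'i * mderive i v (fun x => triv b x (ext0 t x) 0 k) x.
  rewrite (D v) (D ('i *: v)).
  exact: holomorphic_fun_i hgU Ubx ix.
exact: Di.
Qed.

Variable h : hermitianStructure E.

Definition gram a x : 'M[R[i]]_r :=
  \matrix_(k, l) h x (tinv a x (delta_mx 0 k)) (tinv a x (delta_mx 0 l)).

Lemma tinv_sum a x (u : 'rV[R[i]]_r) : tdom a x ->
  tinv a x u = \sum_k u 0 k *: tinv a x (delta_mx 0 k).
Proof.
move=> ax; apply: (triv_inj ax); rewrite tinvK // linear_sum [LHS]row_sum_delta.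
by apply: eq_bigr => k _; rewrite linearZ /= tinvK.
Qed.

Lemma gramE a x (e e' : E x) : tdom a x ->
  h x e e' = (triv a x e *m gram a x *m (triv a x e')^H) 0 0.
Proof.
move=> ax; rewrite -[in LHS](trivK e ax) -[in LHS](trivK e' ax).
move: (triv a x e) (triv a x e') => u u'.
rewrite (tinv_sum u ax) (tinv_sum u' ax).
rewrite (big_morph (fun e => h x e _) (fun e1 e2 => dotDl (h x) e1 e2 _)
  (linear0l _ _)).
rewrite -mulmxA mxE; apply: eq_bigr => k _.
rewrite dotZl mxE; congr (_ * _).
rewrite (big_morph (fun e => h x _ e) (fun e1 e2 => dotDr (h x) e1 e2 _)
  (linear0r _ _)).
by apply: eq_bigr => l _; rewrite dotZr !mxE mulrC.
Qed.

Lemma gram_hermitian a x : (gram a x)^H = gram a x.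
Proof. by apply/matrixP => k l; rewrite !mxE dot_conj. Qed.

(** Definiteness of h: a row u with u H = 0 is the row of components of a vector e with h(e, e) = u
    H u^* = 0, so e = 0. *)
Lemma gram_unit a x : tdom a x -> gram a x \in unitmx.
Proof.
move=> ax; rewrite -row_free_unit -kermx_eq0; apply/eqP/row_matrixP => k.
rewrite row0; set u := row k _.
have uH : u *m gram a x = 0 by apply/sub_kermxP; exact: row_sub.
have : tinv a x u = 0.
  by apply: (dot_nondegenerate (f := h x));
    rewrite (gramE _ _ ax) tinvK // uH mul0mx mxE.
by move=> /(congr1 (triv a x)); rewrite tinvK // linear0.
Qed.

Lemma smooth_gram a : smooth_mx (tdom a) (gram a).
Proof.
have oa : open (tdom a) by exact: tdom_open.
have se k : smooth_section
    (fun x (_ : tdom a x) => tinv a x (delta_mx 0 k) : E x).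
  apply: (@smooth_section_tinv a _ (fun=> delta_mx 0 k)) => //.
  by move=> p q; exact: smooth_fun_cst.
move=> k l; have := herm_smooth h oa (MkA0 (se k)) (MkA0 (se l)).
by apply: eq_smooth_fun => // x ax; rewrite ext0E mxE.
Qed.

Lemma gram_transition a b (g : X -> 'M[R[i]]_r) x :
  (forall e : E x, triv b x e = triv a x e *m g x) ->
  tdom a x -> tdom b x -> gram a x = g x *m gram b x *m (g x)^H.
Proof.
move=> gE ax bx; apply/matrixP => k l; rewrite mxE (gramE _ _ bx) !gE !tinvK //.
rewrite mulmx_conjT -!mulmxA mulmxA -rowE.
have dE : (delta_mx 0 l : 'rV[R[i]]_r)^H = delta_mx l 0.
  by apply/matrixP => p q; rewrite !mxE rmorph_nat andbC.
by rewrite dE !mulmxA -colE -row_mul -row_mul !mxE.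
Qed.

End Bundle.

Arguments smooth_components {R n r X E} a {U s}.
Arguments smooth_gram {R n r X E} h a.

(** * Existence *)

Section ChernConnection.
Variables (R : realType) (n r : nat) (X : complexManifold R n).
Variables (E : holomorphicBundle X r) (h : hermitianStructure E).
Implicit Types (i j : chart X) (U V : set X) (a b : trivialization E).
Implicit Types (v w : 'rV[R[i]]_n) (x y : X).

Definition triv_at x : trivialization E := projT1 (cid (triv_cover E x)).

Lemma triv_atP x : tdom (triv_at x) x.
Proof. exact: projT2 (cid (triv_cover E x)). Qed.

(** The choice [triv_at x] may jump from point to point; it serves only to give a value at x. *)
Definition nabla_at U (s : local_section E U) i v x : E x :=
  tinv (triv_at x) x
    (chern i v (gram h (triv_at x)) (components (triv_at x) s) x).

Lemma components_diff a U (s : local_section E U) i x : smooth_section s ->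
  U x -> tdom a x -> cdom i x -> mxdiff i (components a s) x.
Proof.
move=> ss Ux ax ix.
by apply: (@smooth_mxdiff _ _ _ _ _ (U `&` tdom a)) => //;
  exact: smooth_components.
Qed.

Lemma gram_diff a i x : tdom a x -> cdom i x -> mxdiff i (gram h a) x.
Proof. exact: smooth_mxdiff (smooth_gram h a). Qed.

(** Independence of the trivialization, by [chern_gauge] on the open set [W] where both [a] and the
    chosen one are defined. With [a] fixed and x varying, this describes [nabla_at] by one formula
    on all of [tdom a], which gives its smoothness. *)
Lemma triv_nabla_at a U (s : local_section E U) i v x : open U ->
  smooth_section s -> U x -> cdom i x -> tdom a x ->
  triv a x (nabla_at s i v x) = chern i v (gram h a) (components a s) x.
Proof.
move=> oU ss Ux ix ax; rewrite /nabla_at; set b := triv_at x.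
have bx : tdom b x := triv_atP x.
have [g [hg gE]] := transition b a.
pose W := U `&` (tdom b `&` tdom a).
have oW : open W by apply/openI/openI/tdom_open => //; exact: tdom_open.
have Wx : W x by [].
have hgW : holomorphic_mx W g.
  move=> k l i'; have [sg cg] := hg k l i'; split.
    by move=> vs _ [y [[Uy by_] iy] <-]; apply: sg; exists y.
  by move=> z w [y [[Uy by_] iy] <-]; apply: cg; exists y.
have gr y : W y -> gram h b y = g y *m gram h a y *m (g y)^H.
  by move=> [Uy [by_ ay]]; apply: gram_transition => // e; exact: gE.
have st y : W y -> components a s y = components b s y *m g y.
  by move=> [Uy [by_ ay]]; rewrite /components gE.
rewrite (gE x _ bx ax) tinvK // (eq_chern ix v (gram h a) oW Wx st).
apply/esym/(chern_gauge ix v oW Wx _ _ hgW gr).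
- exact: components_diff.
- exact: gram_diff.
- exact: gram_unit.
Qed.

Lemma nabla_at_linear U (s : local_section E U) i (c : R) v w x : open U ->
  smooth_section s -> U x -> cdom i x ->
  nabla_at s i (c%:C *: v + w) x =
  c%:C *: nabla_at s i v x + nabla_at s i w x.
Proof.
move=> oU ss Ux ix; have ax := triv_atP x; apply: (triv_inj ax).
have nE v' := triv_nabla_at v' oU ss Ux ix ax.
apply: (etrans (nE _)); apply: (etrans (chern_linear _ _ _ _ _)).
- exact: components_diff.
- exact: gram_diff.
by apply/esym/(etrans (linearP _ _ _ _)); congr (_ *: _ + _); exact: nE.
Qed.

Lemma nabla_at_chart U (s : local_section E U) i j v x : open U ->
  smooth_section s -> U x -> cdom i x -> cdom j x ->
  nabla_at s i v x = nabla_at s j (dchart i j x v) x.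
Proof.
move=> oU ss Ux ix jx; have ax := triv_atP x; apply: (triv_inj ax).
apply: (etrans (triv_nabla_at v oU ss Ux ix ax)).
apply: (etrans _ (esym (triv_nabla_at (dchart i j x v) oU ss Ux jx ax))).
by apply: chern_chart => //; [exact: components_diff | exact: gram_diff].
Qed.

Lemma nabla_at_smooth U (s : local_section E U) i v : open U ->
  smooth_section s ->
  smooth_section (fun x (_ : (U `&` cdom i) x) => nabla_at s i v x).
Proof.
move=> oU ss a k.
have oUa : open (U `&` tdom a) by exact/openI/tdom_open.
have oW : open (U `&` cdom i `&` tdom a).
  by apply/openI/tdom_open; exact/openI/cdom_open.
have sH : smooth_mx (U `&` tdom a) (gram h a).
  by move=> p q; apply: sub_smooth_fun (smooth_gram h a p q) => x [].
have uH x : (U `&` tdom a) x -> gram h a x \in unitmx.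
  by move=> [_ ax]; exact: gram_unit.
have sC := smooth_chern i v oUa (smooth_components a ss) sH uH 0 k.
have sC' : smooth_fun (U `&` cdom i `&` tdom a)
    (fun x => chern i v (gram h a) (components a s) x 0 k).
  by apply: sub_smooth_fun sC => x [[Ux ix] ax].
apply: (eq_smooth_fun oW _ sC') => x [[Ux ix] ax].
rewrite (ext0E _ (conj Ux ix : (U `&` cdom i) x)).
by rewrite (triv_nabla_at v oU ss Ux ix ax).
Qed.

(** [triv_at x] depends on x alone, so both sides use the same trivialization and the germ of the
    components at x decides. *)
Lemma nabla_at_local U V (s : local_section E U) (t : local_section E V) i v x :
  open V -> V `<=` U ->
  (forall x (Ux : U x) (Vx : V x), t x Vx = s x Ux) -> V x -> cdom i x ->
  nabla_at t i v x = nabla_at s i v x.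
Proof.
move=> oV VU ts Vx ix.
have st y : V y -> components (triv_at x) t y = components (triv_at x) s y.
  move=> Vy; rewrite (componentsE _ _ Vy) (componentsE _ _ (VU y Vy)).
  by rewrite (ts y (VU y Vy)).
by rewrite /nabla_at (eq_chern ix v _ oV Vx st).
Qed.

Arguments nabla_at_smooth {U s} i v.

Definition chern_nabla U (oU : open U) (s : A0 E U) : A1 E U :=
  @MkA1 _ _ _ _ E U (fun i v x _ => nabla_at s i v x)
    (fun i c v w x Ux =>
       nabla_at_linear c v w oU (@A0_smooth _ _ _ _ _ _ s) Ux.1 Ux.2)
    (fun i j v x Ui Uj =>
       nabla_at_chart v oU (@A0_smooth _ _ _ _ _ _ s) Ui.1 Ui.2 Uj.2)
    (fun i v => nabla_at_smooth i v oU (@A0_smooth _ _ _ _ _ _ s)).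

Lemma chern_nabla_restrict U V (oU : open U) (oV : open V) (s : A0 E U)
  (t : A0 E V) : V `<=` U ->
  (forall x (Ux : U x) (Vx : V x), t x Vx = s x Ux) ->
  forall i v x (Ux : (U `&` cdom i) x) (Vx : (V `&` cdom i) x),
    chern_nabla oV t i v x Vx = chern_nabla oU s i v x Ux.
Proof.
move=> VU ts i v x Ux Vx; exact: nabla_at_local VU ts Vx.1 Vx.2.
Qed.

Lemma chern_nabla_leibniz U (oU : open U) (f : local_fun U) (s u : A0 E U) :
  smooth_local_fun f ->
  (forall x (Ux : U x), u x Ux = f x Ux *: s x Ux) ->
  forall i v x (Ux : (U `&` cdom i) x),
    chern_nabla oU u i v x Ux =
    d0 f v Ux *: s x Ux.1 + f x Ux.1 *: chern_nabla oU s i v x Ux.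
Proof.
move=> sf uE i v x Ux /=; have ax := triv_atP x; apply: (triv_inj ax).
pose F : X -> R[i] := ext0 (F := fun=> R[i]) f.
have uc y : U y ->
    components (triv_at x) u y = F y *: components (triv_at x) s y.
  move=> Uy; rewrite !(componentsE _ _ Uy) uE linearZ /=.
  by rewrite /F (ext0E (F := fun=> R[i]) _ Uy).
have nE t := triv_nabla_at v oU (@A0_smooth _ _ _ _ _ _ t) Ux.1 Ux.2 ax.
have linE (c d : R[i]) (e e' : E x) : triv (triv_at x) x (c *: e + d *: e') =
    c *: triv (triv_at x) x e + d *: triv (triv_at x) x e'.
  by rewrite linearP linearZ.
apply: (etrans (nE u)); apply: (etrans (eq_chern Ux.2 v _ oU Ux.1 uc)).
apply: (etrans (chern_leibniz Ux.2 _ _ _ _)).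
- exact: smooth_fun_mdiff sf Ux.1 Ux.2.
- by apply: components_diff ax Ux.2; [exact: A0_smooth | exact: Ux.1].
apply/esym/(etrans (linE _ _ _ _)); congr (_ *: _ + _ *: _).
- exact/esym/componentsE.
- by rewrite /F (ext0E (F := fun=> R[i]) _ Ux.1).
- exact: nE.
Qed.

Lemma chern_nabla_linear U (oU : open U) (c : R[i]) (s t u : A0 E U) :
  (forall x (Ux : U x), u x Ux = c *: s x Ux + t x Ux) ->
  forall i v x (Ux : (U `&` cdom i) x),
    chern_nabla oU u i v x Ux =
    c *: chern_nabla oU s i v x Ux + chern_nabla oU t i v x Ux.
Proof.
move=> uE i v x Ux /=; have ax := triv_atP x; apply: (triv_inj ax).
(* The scalar is written as a constant function so that [chern_leibniz] applies; its derivative term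
   vanishes. *)
have uc y : U y -> components (triv_at x) u y =
    (fun=> c) y *: components (triv_at x) s y + components (triv_at x) t y.
  by move=> Uy; rewrite !(componentsE _ _ Uy) uE linearP.
have nE z := triv_nabla_at v oU (@A0_smooth _ _ _ _ _ _ z) Ux.1 Ux.2 ax.
have cd (z : A0 E U) : mxdiff i (components (triv_at x) z) x.
  by apply: components_diff ax Ux.2; [exact: A0_smooth | exact: Ux.1].
have dc : mdiff i (fun=> c) x by exact: rdifferentiable_cst.
apply: (etrans (nE u)); apply: (etrans (eq_chern Ux.2 v _ oU Ux.1 uc)).
have dcs : mxdiff i (fun y => (fun=> c) y *: components (triv_at x) s y) x.
  move=> k l; rewrite (_ : (fun y => _) = fun y =>
    c * components (triv_at x) s y k l); last by apply/funext => y; rewrite mxE.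
  exact: rdifferentiableM dc (cd s k l).
apply: (etrans (chernD _ _ dcs (cd t))).
apply/esym/(etrans (linearP _ _ _ _)); congr (_ + _); last exact: nE.
apply/esym/(etrans (chern_leibniz Ux.2 _ _ dc (cd s))).
rewrite mderive_cst scale0r add0r; congr (_ *: _).
exact/esym/nE.
Qed.

Definition chern_connection : connection E :=
  @Connection _ _ _ _ E chern_nabla chern_nabla_restrict chern_nabla_linear
    chern_nabla_leibniz.

Lemma chern_hermitian : hermitian_compatible h chern_connection.
Proof.
move=> U oU s t i v x Ux /=; set a := triv_at x.
have ax : tdom a x := triv_atP x.
have oUa : open (U `&` tdom a) by exact/openI/tdom_open.
(* h(s, t) as a 1 x 1 matrix product, the form to which [chern_metric] applies. *)
pose P y : 'M[R[i]]_1 :=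
  components a s y *m gram h a y *m (components a t y)^H.
pose F : X -> R[i] :=
  ext0 (F := fun=> R[i]) (fun y (Uy : U y) => h y (s y Uy) (t y Uy)).
have FP y : (U `&` tdom a) y -> F y = P y 0 0.
  move=> [Uy ay]; rewrite /F (ext0E (F := fun=> R[i]) _ Uy) (gramE _ _ _ ay).
  by rewrite /P !(componentsE _ _ Uy).
have cd (z : A0 E U) : mxdiff i (components a z) x.
  by apply: components_diff ax Ux.2; [exact: A0_smooth | exact: Ux.1].
have dFP : mderive i v F x = mxderive i v P x 0 0.
  rewrite mxderiveE.
  exact: (eq_mderive v oUa (conj Ux.1 ax : (U `&` tdom a) x) Ux.2 FP).
have nE (z : A0 E U) :=
  triv_nabla_at v oU (@A0_smooth _ _ _ _ _ _ z) Ux.1 Ux.2 ax.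
have gH y : (U `&` tdom a) y -> (gram h a y)^H = gram h a y.
  by move=> _; exact: gram_hermitian.
have metric := chern_metric Ux.2 v oUa (conj Ux.1 ax) (cd s) (cd t)
  (gram_diff ax Ux.2) gH (gram_unit h ax).
apply: (etrans dFP).
apply: (etrans (congr1 (fun M : 'M[R[i]]_1 => M 0 0) metric)).
apply: (etrans (mxE _ _ _ _)); congr (_ + _).
- apply/esym/(etrans (gramE h _ _ ax)).
  by rewrite (nE s) -(componentsE a t Ux.1).
- apply/esym/(etrans (gramE h _ _ ax)).
  by rewrite (nE t) -(componentsE a s Ux.1).
Qed.

(** The holomorphic frame in [is_dbarE] is arbitrary. Its components in a trivialization form a
    holomorphic matrix S, the section has components F S with F the row of coefficients, and dbar(F
    S) = (dbar F) S because dbar S = 0. *)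
Lemma chern_holomorphic : holomorphic_compatible chern_connection.
Proof.
move=> U oU s f u [hs _] sf uE i v x Ux; rewrite /form01 /=.
set a := triv_at x; have ax : tdom a x := triv_atP x.
have ix : cdom i x := Ux.2.
have oUa : open (U `&` tdom a) by exact/openI/tdom_open.
have Uax : (U `&` tdom a) x by split => //; exact: Ux.1.
pose F y : 'rV[R[i]]_r := \row_k ext0 (F := fun=> R[i]) (f k) y.
pose S y : 'M[R[i]]_r := \matrix_(k, l) components a (s k) y 0 l.
have hS : holomorphic_mx (U `&` tdom a) S.
  move=> k l; rewrite (_ : (fun y => _) = fun y => triv a y (ext0 (s k) y) 0 l).
    exact: hs.
  by apply/funext => y; rewrite mxE.
have dF : mxdiff i F x.
  move=> k l; rewrite (_ : (fun y => _) = ext0 (F := fun=> R[i]) (f l)).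
    exact: smooth_fun_mdiff (sf l) Ux.1 ix.
  by apply/funext => y; rewrite mxE.
have dS : mxdiff i S x := smooth_mxdiff (holomorphic_smooth_mx hS) Uax ix.
have uc y : (U `&` tdom a) y -> components a u y = F y *m S y.
  move=> [Uy ay]; rewrite (componentsE _ _ Uy) uE linear_sum /=.
  apply/rowP => l; rewrite summxE mxE; apply: eq_bigr => k _.
  by rewrite linearZ !mxE (componentsE _ _ Uy) (ext0E (F := fun=> R[i]) _ Uy).
have nE w := triv_nabla_at w oU (@A0_smooth _ _ _ _ _ _ u) Ux.1 Ux.2 ax.
have form01E (e e' : E x) u1 u2 : triv a x e = u1 -> triv a x e' = u2 ->
    triv a x (2^-1 *: (e + 'i *: e')) = 2^-1 *: (u1 + 'i *: u2).
  by move=> <- <-; rewrite linearZ linearD linearZ.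
apply: (triv_inj ax); apply: (etrans (form01E _ _ _ _ (nE v) (nE ('i *: v)))).
apply: (etrans (chern_form01 v _ (gram_diff ax ix))).
have D w : mxderive i w (components a u) x =
    mxderive i w F x *m S x + F x *m mxderive i w S x.
  by rewrite (eq_mxderive ix w oUa Uax uc) (mxderiveM ix w dF dS).
have Di := holomorphic_mxderive_i ix v hS Uax.
have dbarM (A A' u0 : 'rV[R[i]]_r) (B B' C : 'M[R[i]]_r) : B' = 'i *: B ->
    A *m C + u0 *m B + 'i *: (A' *m C + u0 *m B') = (A + 'i *: A') *m C.
  move=> ->; rewrite scalerDr -scalemxAr scalerA mul_ii scaleN1r.
  by rewrite addrACA subrr addr0 mulmxDl -scalemxAl.
have -> : mxderive i v (components a u) x +
    'i *: mxderive i ('i *: v) (components a u) x =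
    (mxderive i v F x + 'i *: mxderive i ('i *: v) F x) *m S x.
  apply: (etrans _ (dbarM _ _ _ _ _ _ Di)).
  by congr (_ + _ *: _); exact: D.
rewrite linear_sum /= scalemxAl; apply/rowP => l; rewrite mxE summxE.
apply: eq_bigr => k _; rewrite linearZ [in RHS]mxE -(componentsE a (s k) Ux.1).
congr (_ * _); last by rewrite mxE.
have entry (A B : 'rV[R[i]]_r) :
    (2^-1 *: (A + 'i *: B)) 0 k = 2^-1 * (A 0 k + 'i * B 0 k).
  by rewrite !mxE.
apply: (etrans (entry _ _)); rewrite /dbar0.
by congr (_ * (_ + _ * _)); apply: (etrans (mxderiveE _ _ _ _ _ _));
  congr (mderive i _ _ x); apply/funext => y; rewrite mxE.
Qed.

End ChernConnection.

(** * Uniqueness *)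

Section Uniqueness.
Variables (R : realType) (n r : nat) (X : complexManifold R n).
Variables (E : holomorphicBundle X r) (h : hermitianStructure E).

(** Uniqueness is equality of records: beyond the values, the proofs stored in each form and in the
    connections are identified by proof irrelevance. *)
Lemma connection_ext (D D' : connection E) :
  (forall U (oU : open U) (s : A0 E U) i v x Ux,
    D U oU s i v x Ux = D' U oU s i v x Ux) -> D = D'.
Proof.
case: D D' => [D p1 p2 p3] [D' q1 q2 q3] /= DD'.
have eqD : D = D'.
  apply/functional_extensionality_dep => U.
  apply/functional_extensionality_dep => oU.
  apply/functional_extensionality_dep => s.
  have : A1_val (D U oU s) = A1_val (D' U oU s).
    apply/functional_extensionality_dep => i.
    apply/functional_extensionality_dep => v.
    apply/functional_extensionality_dep => x.
    apply/functional_extensionality_dep => Ux.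
    exact: DD'.
  case: (D U oU s) (D' U oU s) => [w a1 a2 a3] [w' b1 b2 b3] /= ww'.
  subst w'.
  by rewrite (Prop_irrelevance a1 b1) (Prop_irrelevance a2 b2)
    (Prop_irrelevance a3 b3).
subst D'.
by rewrite (Prop_irrelevance p1 q1) (Prop_irrelevance p2 q2)
  (Prop_irrelevance p3 q3).
Qed.

(** * Uniqueness over an open set inside a trivialization *)

Section Local.
Variables (a : trivialization E) (V : set X).
Hypotheses (oV : open V) (Va : V `<=` tdom a).

Let frame k : local_section E V := fun x _ => tinv a x (delta_mx 0 k).

Let frame_holomorphic : holomorphic_frame frame.
Proof.
split=> [k|x Vx e]; first exact: (@holomorphic_section_frame _ _ _ _ _ a V _ k).
have ax := Va Vx; exists (triv a x e); split.
  by rewrite -[LHS](trivK e ax) [LHS]tinv_sum.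
by move=> c ->; rewrite -tinv_sum // tinvK.
Qed.

(** Over [V] every smooth section is a combination of one holomorphic frame with smooth
    coefficients, so [is_dbarE] prescribes its (0,1)-component. *)
Let form01_unique (D D' : connection E) :
  holomorphic_compatible D -> holomorphic_compatible D' ->
  forall (t : A0 E V) i v x (Vx : (V `&` cdom i) x),
  form01 (A1_val (D V oV t)) v Vx = form01 (A1_val (D' V oV t)) v Vx.
Proof.
move=> hD hD' t i v x Vx.
pose f k : local_fun V := fun y Vy => triv a y (t y Vy) 0 k.
have sf k : smooth_local_fun (f k).
  have st := sub_smooth_fun _ (A0_smooth (a := a) t k).
  apply: (eq_smooth_fun oV _ (st _ _)) => y Vy.
    by rewrite (ext0E _ Vy) (ext0E (F := fun=> R[i]) _ Vy).
  by split => //; exact: Va.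
have tf y (Vy : V y) : t y Vy = \sum_k f k y Vy *: frame k Vy.
  by rewrite -[LHS](trivK _ (Va Vy)) [LHS]tinv_sum //; exact: Va.
exact: etrans (hD V oV frame f t frame_holomorphic sf tf i v x Vx)
  (esym (hD' V oV frame f t frame_holomorphic sf tf i v x Vx)).
Qed.

Lemma local_uniqueness (D D' : connection E) :
  hermitian_compatible h D -> holomorphic_compatible D ->
  hermitian_compatible h D' -> holomorphic_compatible D' ->
  forall (t : A0 E V) i v x (Vx : (V `&` cdom i) x),
  D V oV t i v x Vx = D' V oV t i v x Vx.
Proof.
move=> mD hD mD' hD' t i v x Vx.
have two0 : 2^-1 != 0 :> R[i] by rewrite invr_eq0 pnatr_eq0.
have F01 (z : A0 E V) :
    D V oV z i v x Vx + 'i *: D V oV z i ('i *: v) x Vx =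
    D' V oV z i v x Vx + 'i *: D' V oV z i ('i *: v) x Vx.
  by apply: (scalerI two0); exact: (form01_unique hD hD' z v Vx).
(* As h is conjugate-linear on the right, the factor - i becomes + i there: twice the (1,0)-part of
   nabla t is paired with z, and t with twice the (0,1)-part of nabla z. *)
have polar (e e' w u u1 u2 : E x) :
    (h x e w + h x u u1) - 'i * (h x e' w + h x u u2) =
    h x (e - 'i *: e') w + h x u (u1 + 'i *: u2).
  have -> : e - 'i *: e' = e + (- 'i) *: e' by rewrite scaleNr.
  rewrite (dotDl (h x) e) (dotZl (h x)) (dotDr (h x) u1) (dotZr (h x)) conj_i.
  by move: (h x e w) (h x e' w) (h x u u1) (h x u u2) => *; ring.
have F10 : D V oV t i v x Vx - 'i *: D V oV t i ('i *: v) x Vx =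
    D' V oV t i v x Vx - 'i *: D' V oV t i ('i *: v) x Vx.
  set d := _ - _; set d' := RHS.
  apply/eqP; rewrite -subr_eq0; apply/eqP.
  have ax : tdom a x := Va Vx.1.
  (* The test section [z] has constant components and takes at x the value d - d'. Its (0,1)-parts
     under D and D' agree by [F01], so h(d, d - d') = h(d', d - d'), and definiteness gives d =
     d'. *)
  pose w := triv a x (d - d').
  have sz : smooth_section (fun y (_ : V y) => tinv a y w : E y).
    apply: (@smooth_section_tinv _ _ _ _ _ a _ (fun=> w)) => // k l.
    exact: smooth_fun_cst.
  pose z := MkA0 sz.
  have zx : z x Vx.1 = d - d' by exact: trivK.
  have metric (D0 : connection E) : hermitian_compatible h D0 ->
      d0 (fun y (Vy : V y) => h y (t y Vy) (z y Vy)) v Vx -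
      'i * d0 (fun y (Vy : V y) => h y (t y Vy) (z y Vy)) ('i *: v) Vx =
      h x (D0 V oV t i v x Vx - 'i *: D0 V oV t i ('i *: v) x Vx) (d - d') +
      h x (t x Vx.1)
        (D0 V oV z i v x Vx + 'i *: D0 V oV z i ('i *: v) x Vx).
    move=> mD0; rewrite -zx -polar //.
    by congr (_ - _ * _); exact: mD0.
  have := etrans (esym (metric D mD)) (metric D' mD').
  rewrite (F01 z) => /addIr E0.
  apply: (dot_nondegenerate (f := h x)).
  by rewrite -/d -/d' in E0; rewrite dotDl E0 -dotDl subrr linear0l.
(* The value at v is the sum of its (0,1)- and (1,0)-parts, and both are now known to agree. *)
have half (e e' : E x) : e = 2^-1 *: ((e + e') + (e - e')).
  rewrite addrACA subrr addr0 -{2 3}[e]scale1r -scalerDl scalerA.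
  by rewrite mulVf ?scale1r // pnatr_eq0.
rewrite [LHS](half _ ('i *: D V oV t i ('i *: v) x Vx)).
rewrite [RHS](half _ ('i *: D' V oV t i ('i *: v) x Vx)).
by rewrite (F01 t) F10.
Qed.

End Local.

End Uniqueness.

Theorem mainTheorem6 (R : realType) (n r : nat) (X : complexManifold R n)
    (E : holomorphicBundle X r) (h : hermitianStructure E) :
  exists! D : connection E,
    hermitian_compatible h D /\ holomorphic_compatible D.
Proof.
exists (chern_connection h); split.
  by split; [exact: chern_hermitian | exact: chern_holomorphic].
move=> D [mD hD]; apply: connection_ext => U oU s i v x Ux.
(* [U] need not carry a holomorphic frame, so the comparison at x is made after restricting s to the
   trivializing neighbourhood [V]; [nabla_restrict] carries the result back to [U]. *)
pose a := triv_at E x; pose V := U `&` tdom a.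
have oV : open V by exact/openI/tdom_open.
have ss : smooth_section (fun y (Vy : V y) => s y Vy.1).
  move=> b k; have oVb : open (V `&` tdom b) by exact/openI/tdom_open.
  have sU : smooth_fun (V `&` tdom b) (fun y => triv b y (ext0 s y) 0 k).
    by apply: sub_smooth_fun (A0_smooth (a := b) s k) => y [[Uy _] by_].
  apply: (eq_smooth_fun oVb _ sU) => y [Vy _].
  by rewrite (ext0E _ Vy) (ext0E _ Vy.1).
pose sV := MkA0 ss.
have VU : V `<=` U by move=> y [].
have sVE y (Uy : U y) (Vy : V y) : sV y Vy = s y Uy.
  by rewrite (Prop_irrelevance Uy Vy.1).
have Vx : (V `&` cdom i) x.
  by split; [split; [exact: Ux.1 | exact: triv_atP] | exact: Ux.2].
have res (D0 : connection E) : D0 V oV sV i v x Vx = D0 U oU s i v x Ux.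
  exact: nabla_restrict VU sVE i v x Ux Vx.
rewrite -!res; apply: (local_uniqueness (h := h) (a := a)) => //.
- by move=> y [].
- exact: chern_hermitian.
- exact: chern_holomorphic.
Qed.
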